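(* Let $f:\mathbb{C}\to\mathbb{C}$ be a polynomial of degree $N\geq 2$, let $p$ be an attracting fixed point of $f$, let $\mathcal{A}(p)$ be the basin of attraction of $p$, let $\Omega_i$ ($i=1,2,\dots$) be the connected components of $\mathcal{A}(p)$, and let $\Omega_1$ be the immediate basin of attraction of $p$. Suppose that $f^{-1}(p)\cap\Omega_1\neq\{p\}$. Then there is a constant $\tilde{C}$ such that for every $i$ and every point $z_0\in\Omega_i$ there exists a point $q\in\Omega_i\cap\bigcup_{k\geq 0} f^{-k}(p)$ with $d_{\Omega_i}(z_0,q)\leq\tilde{C}$, where $d_{\Omega_i}$ is the Kobayashi distance on $\Omega_i$. (The constant $\tilde C$ depends neither on $i$ nor on $z_0$.)
   Context: A fixed point $p$ of $f$ is attracting if $|f'(p)|<1$. The basin of attraction of $p$ is $\mathcal{A}(p)=\{z\in\mathbb{C}: f^n(z)\to p \text{ as } n\to\infty\}$, where $f^n$ is the $n$-fold iterate of $f$; the immediate basin of attraction of $p$ is the connected component of $\mathcal{A}(p)$ containing $p$. The family of components $\Omega_i$ may be finite (a single component) or infinite. For $k\ge 0$, $f^{-k}(p)=\{z\in\mathbb{C}: f^k(z)=p\}$. Kobayashi distance: let $\triangle$ be the open unit disk. For a domain $U\subset\mathbb{C}$, $z\in U$ and $\xi\in\mathbb{C}$, put $F_U(z,\xi)=\inf\{\lambda>0: \exists\, h:\triangle\to U \text{ holomorphic with } h(0)=z,\ \lambda h'(0)=\xi\}$. For a piecewise smooth curve $\gamma:[0,1]\to U$ put $L_U(\gamma)=\int_0^1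 F_U(\gamma(t),\gamma'(t))\,dt$. For $z_1,z_2\in U$, $d_U(z_1,z_2)$ is the infimum of $L_U(\gamma)$ over all piecewise smooth curves $\gamma$ in $U$ joining $z_1$ to $z_2$. For $U=\triangle$ one has $F_\triangle(z,\xi)=|\xi|/(1-|z|^2)$. *)

(* Defs.v *)
From HB Require Import structures.
From mathcomp Require Import all_boot all_order all_algebra.
From mathcomp Require Import complex.
From mathcomp Require Import all_classical all_reals all_analysis.

Set Implicit Arguments.
Unset Strict Implicit.
Unset Printing Implicit Defensive.

Import Order.TTheory GRing.Theory Num.Theory.
Import numFieldNormedType.Exports.

Local Open Scope classical_set_scope.
Local Open Scope ring_scope.

(* The regular module R[i]^o carries the topology of the modulus and is a
   normed module over R[i]; hence derivable and derive1 for functions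
   Cplx R -> Cplx R are the complex ones. *)
Notation Cplx R := ((complex R)^o).

Section Kobayashi.
Variable R : realType.

(* Only the values of h on the open unit disk matter. *)
Definition holomorphic_disk_map (U : set (Cplx R)) (h : Cplx R -> Cplx R) :=
  forall z : Cplx R, `|z| < 1 -> derivable h z 1 /\ U (h z).

Definition kobayashi_metric (U : set (Cplx R)) (z xi : Cplx R) : \bar R :=
  ereal_inf [set lam%:E | lam in [set lam : R | 0 < lam /\
    exists h : Cplx R -> Cplx R, [/\ holomorphic_disk_map U h, h 0 = z &
      real_complex R lam * derive1 h 0 = xi]]].

(* The derivative with respect to a real parameter, taken coordinatewise. *)
Definition curve_derivable (g : R -> Cplx R) (t : R) :=
  derivable (fun s => complex.Re (g s)) t 1 /\
  derivable (fun s => complex.Im (g s)) t 1.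

Definition curve_derive (g : R -> Cplx R) (t : R) : Cplx R :=
  Complex (derive1 (fun s => complex.Re (g s)) t)
          (derive1 (fun s => complex.Im (g s)) t).

(* Continuous on [0, 1] and C^1 on each closed interval of a finite partition;
   C^1 up to the end points means that the derivative in the open interval
   extends continuously to the closed one. *)
Definition piecewise_smooth (g : R -> Cplx R) :=
  {within `[0, 1]%classic, continuous g} /\
  exists2 s : seq R, itv_partition 0 1 s &
    forall i, (i < size s)%N ->
      let a := nth 1 (0 :: s) i in let b := nth 1 (0 :: s) i.+1 in
      exists v : R -> Cplx R, {within `[a, b]%classic, continuous v} /\
        forall t, a < t < b -> curve_derivable g t /\ curve_derive g t = v t.

(* curve_derive is unspecified at the finitely many points of the partition,
   which does not affect the Lebesgue integral. *)
Definition kobayashi_length (U : set (Cplx R)) (g : R -> Cplx R) : \bar R :=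
  (\int[@lebesgue_measure R]_(t in `[0%R, 1%R]%classic)
     kobayashi_metric U (g t) (curve_derive g t))%E.

Definition kobayashi_dist (U : set (Cplx R)) (z1 z2 : Cplx R) : \bar R :=
  ereal_inf [set kobayashi_length U g | g in [set g : R -> Cplx R |
    [/\ piecewise_smooth g, (forall t, 0 <= t <= 1 -> U (g t)),
        g 0 = z1 & g 1 = z2]]].

End Kobayashi.

Section Basin.
Variables (R : realType) (f : {poly R[i]}) (p : Cplx R).

Definition attracting_fixed_point := f.[p] = p /\ `|(deriv f).[p]| < 1.

Definition basin : set (Cplx R) :=
  [set z : Cplx R | iter n (horner f) z @[n --> \oo] --> p].

Definition basin_component (U : set (Cplx R)) :=
  exists2 z, basin z & U = connected_component basin z.

Definition immediate_basin : set (Cplx R) := connected_component basin p.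

Definition iter_preimage (k : nat) : set (Cplx R) :=
  [set z : Cplx R | iter k (horner f) z = p].

End Basin.

(* Main.v *)
Require Import Defs.
From mathcomp Require Import all_boot all_order all_algebra.
From mathcomp Require Import complex.
From mathcomp Require Import all_classical all_reals all_analysis.
From mathcomp Require Import measurable_realfun.
From mathcomp Require Import ring lra.

Set Implicit Arguments.
Unset Strict Implicit.
Unset Printing Implicit Defensive.

Import Order.TTheory GRing.Theory Num.Theory.
Import numFieldNormedType.Exports.

Local Open Scope classical_set_scope.
Local Open Scope ring_scope.

(* Call [x] good when there are bounds, uniform in [n] and in the points [z] with
   [f^n(z)] near [x], on the number of half-size holomorphic disks of the basin
   that lead from [z] to some iterated preimage of [p].  If a ball around [x]
   avoids the postcritical set, all inverse branches of all the [f^n] exist on it: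
   then goodness spreads from a point near [x] to [x], and [x] is good if it is
   itself an iterated preimage of [p].  Moreover [x] is good as soon as all its
   preimages are, and the backward orbits of a point [x <> p] of the basin leave
   the postcritical set after a bounded number of steps.  Hence the iterated
   preimages of [p] other than [p] are good, and the good points are closed in the
   basin minus [p].  Since the immediate basin is connected and contains a
   preimage of [p] other than [p], good points accumulate at [p], so they fill a
   punctured disk around [p], and pulling back by [f] they fill the basin minus
   [p].  Finally the last point of an orbit before it enters a small disk around
   [p] ranges over a compact subset of the basin minus [p]. *)

(** * Complex polynomials *)

Section Modulus.
Variable R : realType.
Implicit Types (z w : R[i]) (r : R).

Definition nm z : R := ComplexField.Normc.normc z.

Lemma normE z : `|z| = (nm z)%:C%C. Proof. by []. Qed.

Lemma nm_ge0 z : 0 <= nm z.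
Proof. by rewrite -lecR -normE normr_ge0. Qed.

Lemma nm0 : nm 0 = 0. Proof. by apply: complexI; rewrite -normE normr0. Qed.

Lemma nm1 : nm 1 = 1. Proof. by apply: complexI; rewrite -normE normr1. Qed.

Lemma nm_eq0 z : (nm z == 0) = (z == 0).
Proof. by rewrite -(normr_eq0 z) normE (inj_eq (@complexI R)). Qed.

Lemma nm_gt0 z : (0 < nm z) = (z != 0).
Proof. by rewrite -nm_eq0 lt_neqAle nm_ge0 andbT eq_sym. Qed.

Lemma nmM z w : nm (z * w) = nm z * nm w.
Proof. by apply: complexI; rewrite rmorphM -!normE normrM. Qed.

Lemma nmV z : nm z^-1 = (nm z)^-1.
Proof. by apply: complexI; rewrite fmorphV -!normE normfV. Qed.

Lemma nmX z n : nm (z ^+ n) = nm z ^+ n.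
Proof. by apply: complexI; rewrite rmorphXn -!normE normrX. Qed.

Lemma nmN z : nm (- z) = nm z.
Proof. by apply: complexI; rewrite -!normE normrN. Qed.

Lemma nmBC z w : nm (z - w) = nm (w - z).
Proof. by rewrite -nmN opprB. Qed.

Lemma nmD z w : nm (z + w) <= nm z + nm w.
Proof. by rewrite -lecR rmorphD -!normE ler_normD. Qed.

Lemma nm_dist z w x : nm (z - x) <= nm (z - w) + nm (w - x).
Proof. by apply: le_trans (nmD _ _); rewrite addrA subrK. Qed.

Lemma nm_lB z w : nm z - nm w <= nm (z - w).
Proof. by rewrite lerBlDr; apply: le_trans (nmD _ _); rewrite subrK. Qed.

Lemma nm_real r : nm r%:C%C = `|r|.
Proof. by rewrite /nm /= expr0n /= addr0 sqrtr_sqr. Qed.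

Lemma nm_Re z : `|complex.Re z| <= nm z.
Proof. by rewrite -lecR -normE normc_ge_Re. Qed.

Lemma nm_Im z : `|complex.Im z| <= nm z.
Proof.
case: z => a b; rewrite /nm /= -sqrtr_sqr ler_sqrt ?lerDr ?sqr_ge0 //.
by rewrite addr_ge0 ?sqr_ge0.
Qed.

Lemma nm_le_ReIm z : nm z <= `|complex.Re z| + `|complex.Im z|.
Proof.
case: z => a b; rewrite /nm /= -[leRHS]ger0_norm ?addr_ge0 // -sqrtr_sqr.
rewrite ler_sqrt ?sqr_ge0 // sqrrD !real_normK ?num_real //.
by rewrite lerD2r lerDl mulrn_wge0 // mulr_ge0.
Qed.

End Modulus.

Section Polynomials.
Variable R : realType.
Implicit Types (F : {poly R[i]}) (z w x y a : R[i]) (r e : R).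

Lemma poly_lipschitz F r : exists2 L : R, 0 < L & forall x y,
  nm x <= r -> nm y <= r -> nm (F.[y] - F.[x]) <= L * nm (y - x).
Proof.
wlog r0 : r / 0 <= r.
  move=> /(_ (Num.max r 0)) []; first by rewrite le_max lexx orbT.
  by move=> L L0 HL; exists L => // x y xr yr; apply: HL; rewrite le_max ?xr ?yr.
elim/poly_ind: F => [|F c [L L0 IH]].
  by exists 1 => // x y _ _; rewrite !horner0 subrr nm0 mul1r nm_ge0.
exists (r * L + nm F.[0] + L * r + 1).
  by rewrite ltr_wpDl // !addr_ge0 ?mulr_ge0 ?nm_ge0 // ltW.
move=> x y xr yr; rewrite !(hornerMX, hornerD, hornerC).
have -> : F.[y] * y + c - (F.[x] * x + c) =
  y * (F.[y] - F.[x]) + F.[x] * (y - x) by ring.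
apply: le_trans (nmD _ _) _; rewrite !nmM.
have Fx : nm F.[x] <= nm F.[0] + L * r.
  have := IH 0 x; rewrite nm0 subr0 => /(_ r0 xr) H.
  have := nm_lB F.[x] F.[0]; have : L * nm x <= L * r by rewrite ler_pM2l.
  lra.
rewrite !mulrDl mul1r -mulrDl; have n0 := nm_ge0 (y - x).
have : nm y * nm (F.[y] - F.[x]) <= r * (L * nm (y - x)).
  by rewrite ler_pM ?nm_ge0 ?IH.
have : nm F.[x] * nm (y - x) <= (nm F.[0] + L * r) * nm (y - x).
  by rewrite ler_wpM2r.
lra.
Qed.

Lemma poly_bounded F r : exists2 L : R, 0 < L & forall x,
  nm x <= r -> nm F.[x] <= L.
Proof.
case: (leP 0 r) => [r0|r0]; last first.
  by exists 1 => // x /(le_lt_trans)/(_ r0); rewrite ltNge nm_ge0.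
have [L L0 HL] := poly_lipschitz F r.
exists (nm F.[0] + L * r + 1).
  by rewrite ltr_wpDl // !addr_ge0 ?mulr_ge0 ?nm_ge0 // ltW.
move=> x xr; have := HL 0 x; rewrite nm0 subr0 => /(_ r0 xr) H.
have := nm_lB F.[x] F.[0]; have : L * nm x <= L * r by rewrite ler_pM2l.
lra.
Qed.

Lemma poly_taylor1 F r : exists2 L : R, 0 < L & forall x y,
  nm x <= r -> nm y <= r ->
  nm (F.[y] - F.[x] - F^`().[x] * (y - x)) <= L * nm (y - x) ^+ 2.
Proof.
wlog r0 : r / 0 <= r.
  move=> /(_ (Num.max r 0)) []; first by rewrite le_max lexx orbT.
  by move=> L L0 HL; exists L => // x y xr yr; apply: HL; rewrite le_max ?xr ?yr.
elim/poly_ind: F => [|F c [L L0 IH]].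
  exists 1 => // x y _ _.
  by rewrite derivC !hornerC mul0r !subr0 nm0 mul1r exprn_ge0 ?nm_ge0.
have [M M0 HM] := poly_bounded F^`() r.
exists (r * L + M); first by rewrite ltr_wpDl // mulr_ge0 // ltW.
move=> x y xr yr; rewrite derivD derivC derivM derivX.
rewrite !(hornerMX, hornerD, hornerC, mulr1, addr0).
have -> : F.[y] * y + c - (F.[x] * x + c) - (F^`().[x] * x + F.[x]) * (y - x) =
  y * (F.[y] - F.[x] - F^`().[x] * (y - x)) + F^`().[x] * (y - x) ^+ 2 by ring.
apply: le_trans (nmD _ _) _; rewrite nmM (nmM F^`().[x]) nmX mulrDl lerD //.
  by rewrite -mulrA ler_pM ?nm_ge0 ?IH.
by rewrite ler_wpM2r ?exprn_ge0 ?nm_ge0 ?HM.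
Qed.

Lemma nm_prod_ge (s : seq R[i]) z e : 0 <= e ->
  (forall x, x \in s -> e <= nm (z - x)) ->
  e ^+ size s <= nm (\prod_(x <- s) (z - x)).
Proof.
move=> e0; elim: s => [|x s IH] H; first by rewrite big_nil nm1 expr0.
rewrite big_cons nmM /= exprS ler_pM ?exprn_ge0 ?H ?mem_head //.
by apply: IH => y ys; rewrite H // inE ys orbT.
Qed.

Lemma poly_roots F : F != 0 -> exists2 s : seq R[i], size s = (size F).-1 &
  forall z, F.[z] = lead_coef F * \prod_(x <- s) (z - x).
Proof.
move=> F0; have [s Fs] := closed_field_poly_normal F.
exists s.
  have := congr1 (fun p : {poly R[i]} => size p) Fs.
  by rewrite size_scale ?lead_coef_eq0 // size_prod_XsubC => ->.
move=> z; rewrite {1}Fs hornerZ horner_prod; congr (_ * _).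
by apply: eq_bigr => x _; rewrite hornerXsubC.
Qed.

Lemma nm_lead_gt0 F : F != 0 -> 0 < nm (lead_coef F).
Proof. by rewrite nm_gt0 lead_coef_eq0. Qed.

Lemma root_in_roots F (s : seq R[i]) :
  (forall z, F.[z] = lead_coef F * \prod_(x <- s) (z - x)) ->
  forall x, x \in s -> F.[x] = 0.
Proof.
move=> Fs x xs; rewrite Fs (big_rem x) //= subrr mul0r mulr0 //.
Qed.

Lemma poly_coercive F r : (1 < size F)%N ->
  exists M : R, forall z, nm F.[z] <= r -> nm z <= M.
Proof.
move=> sF; have F0 : F != 0 by rewrite -size_poly_gt0 ltnW.
have l0 := nm_lead_gt0 F0.
wlog r0 : r / 0 <= r.
  move=> /(_ (Num.max r 0)) []; first by rewrite le_max lexx orbT.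
  by move=> M HM; exists M => z zr; apply: HM; rewrite le_max zr.
have [s ss Fs] := poly_roots F0.
pose c := 1 + r / nm (lead_coef F).
have c1 : 1 <= c by rewrite lerDl divr_ge0 // ltW.
exists (c + \sum_(x <- s) nm x) => z zr; rewrite leNgt; apply/negP => zM.
have c0 : 0 <= c by rewrite (le_trans _ c1).
have /nm_prod_ge : forall x, x \in s -> c <= nm (z - x).
  move=> x xs; apply: le_trans (nm_lB _ _).
  move: zM; rewrite (big_rem x) //=.
  have : 0 <= \sum_(y <- rem x s) nm y by rewrite sumr_ge0 // => *; exact: nm_ge0.
  lra.
move=> /(_ c0); have : c <= c ^+ size s.
  by rewrite ss; case: (size F) sF => [|[|n]] //= _; rewrite exprS ler_peMr // exprn_ege1.
move: zr; rewrite Fs nmM => zr cc cp.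
have : nm (lead_coef F) * c <= r.
  by apply: le_trans zr; rewrite ler_pM2l //; apply: le_trans cp.
rewrite /c mulrDr mulr1 mulrCA divff ?gt_eqF //; lra.
Qed.

Lemma root_near F e : (1 < size F)%N -> 0 < e -> exists2 d : R, 0 < d &
  forall z w, nm (F.[z] - w) < d -> exists2 y, F.[y] = w & nm (y - z) < e.
Proof.
move=> sF e0; have F0 : F != 0 by rewrite -size_poly_gt0 ltnW.
exists (nm (lead_coef F) * e ^+ (size F).-1).
  by rewrite mulr_gt0 ?exprn_gt0 ?nm_lead_gt0.
move=> z w.
have sz : size (F - w%:P) = size F.
  by rewrite size_polyDl // size_polyN size_polyC; apply: leq_ltn_trans sF; case: (w != 0).
have lc : lead_coef (F - w%:P) = lead_coef F.
  by rewrite lead_coefDl // size_polyN size_polyC; apply: leq_ltn_trans sF; case: (w != 0).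
have G0 : F - w%:P != 0 by rewrite -size_poly_gt0 sz ltnW.
have [s ss Fs] := poly_roots G0.
have -> : F.[z] - w = (F - w%:P).[z] by rewrite !hornerE.
rewrite Fs nmM lc ltr_pM2l ?nm_lead_gt0 // -sz -ss.
move=> H; have [y ys yz] : exists2 y, y \in s & nm (z - y) < e.
  apply: contrapT => /forall2NP N.
  have /nm_prod_ge : forall x, x \in s -> e <= nm (z - x).
    by move=> x xs; case: (N x) => //; rewrite leNgt => /negP.
  by move=> /(_ (ltW e0)); rewrite leNgt H.
exists y; last by rewrite nmBC.
by have /eqP := root_in_roots Fs ys; rewrite !hornerE subr_eq0 => /eqP.
Qed.

Lemma deriv_neq0 F : (1 < size F)%N -> F^`() != 0.
Proof.
move=> sF; apply/eqP => /(congr1 (fun p : {poly R[i]} => p`_(size F).-2)) /eqP.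
have F0 : F != 0 by rewrite -size_poly_gt0 ltnW.
rewrite coef_deriv coef0 mulrn_eq0 /= prednK ?[F`_ _ == 0](lead_coef_eq0 F) ?(negPf F0) //.
by case: (size F) sF => [|[]].
Qed.

Lemma deriv_lower_bound F a r r' : (1 < size F)%N -> r < r' ->
  (forall c, F^`().[c] = 0 -> r' <= nm (F.[c] - a)) ->
  exists2 m : R, 0 < m & forall z, nm (F.[z] - a) <= r -> m <= nm F^`().[z].
Proof.
move=> sF rr' Hc; have D0 := deriv_neq0 sF.
have [s _ Ds] := poly_roots D0.
have [M HM] := poly_coercive (r + nm a) sF.
pose M' := Num.max M (\sum_(x <- s) nm x).
have [L L0 HL] := poly_lipschitz F M'.
exists (nm (lead_coef F^`()) * ((r' - r) / L) ^+ size s).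
  by rewrite mulr_gt0 ?nm_lead_gt0 // exprn_gt0 // divr_gt0 // subr_gt0.
move=> z zr; rewrite Ds nmM ler_pM2l ?nm_lead_gt0 //.
apply: nm_prod_ge; first by rewrite divr_ge0 ?(ltW L0) // subr_ge0 ltW.
move=> x xs; rewrite ler_pdivrMr // mulrC.
have zM : nm z <= M' by rewrite le_max HM //; have := nm_lB F.[z] a; lra.
have xM : nm x <= M'.
  rewrite le_max; apply/orP; right; rewrite (big_rem x) //= lerDl sumr_ge0 // => *.
  exact: nm_ge0.
have := HL x z xM zM; have := Hc x (root_in_roots Ds xs).
have := nm_dist F.[x] F.[z] a; rewrite (nmBC F.[x] F.[z]); lra.
Qed.

Lemma preimages_separated F a r r' : (1 < size F)%N -> r < r' ->
  (forall c, F^`().[c] = 0 -> r' <= nm (F.[c] - a)) ->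
  exists2 e : R, 0 < e & forall x y, F.[x] = F.[y] -> nm (F.[x] - a) <= r ->
    x != y -> e <= nm (x - y).
Proof.
move=> sF rr' Hc; have [m m0 Hm] := deriv_lower_bound sF rr' Hc.
have [M HM] := poly_coercive (r + nm a) sF.
have [L L0 HL] := poly_taylor1 F M.
exists (m / L); first by rewrite divr_gt0.
move=> x y xy xr nxy; rewrite ler_pdivrMr //.
have xM : nm x <= M by rewrite HM //; have := nm_lB F.[x] a; lra.
have yM : nm y <= M by rewrite HM // -xy; have := nm_lB F.[x] a; lra.
have := HL x y xM yM; rewrite xy subrr sub0r -(opprB x y) mulrN opprK nmN nmM.
rewrite expr2 mulrA ler_pM2r ?nm_gt0 ?subr_eq0 // => H.
by rewrite mulrC; apply: le_trans H; apply: Hm.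
Qed.

End Polynomials.

(** * Inverse branches of polynomials *)

Section Lifting.
Variable R : realType.
Implicit Types (F : {poly R[i]}) (z w x y a u : R[i]) (r e s : R).

Definition section_on F a z0 r (g : R[i] -> R[i]) := [/\ g a = z0,
  forall u, nm (u - a) <= r -> F.[g u] = u &
  forall u, nm (u - a) <= r -> forall e, 0 < e -> exists2 d : R, 0 < d &
    forall v, nm (v - a) <= r -> nm (v - u) < d -> nm (g v - g u) < e].

(* The section is extended from radius [s] to radius [s'] by choosing, over [u],
   the only preimage close to the value of the old section at a nearby point
   [sh u] of the smaller ball. *)
Lemma section_extend F a z0 s s' r r' (eta sigma : R) g :
  0 < eta -> (forall x y, F.[x] = F.[y] -> nm (F.[x] - a) <= r ->
    x != y -> eta <= nm (x - y)) ->
  (forall e, 0 < e -> exists2 d : R, 0 < d &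
    forall z w, nm (F.[z] - w) < d -> exists2 y, F.[y] = w & nm (y - z) < e) ->
  (forall z w, nm (F.[z] - w) < sigma ->
    exists2 y, F.[y] = w & nm (y - z) < eta / 4) ->
  0 <= s -> s <= s' -> s' - s < sigma -> s' <= r -> r < r' -> F.[z0] = a ->
  section_on F a z0 s g -> exists g', section_on F a z0 s' g'.
Proof.
move=> eta0 sep near_ near4 s0 ss' s's s'r rr' Fz0 [ga gF gc].
have s'0 := le_trans s0 ss'.
have [cc [cc0 cc1 ccs]] : exists cc : R, [/\ 0 <= cc, cc <= 1 & cc * s' = s].
  have [s'E|s'N0] := eqVneq s' 0.
    exists 0; rewrite mul0r lexx ler01; split => //; apply/eqP.
    by rewrite eq_le s0 -s'E ss'.
  exists (s / s'); rewrite divfK // divr_ge0 //; split => //.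
  by rewrite ler_pdivrMr ?mul1r // lt_neqAle eq_sym s'N0.
pose sh u : R[i] := a + cc%:C%C * (u - a).
have shB u v : nm (sh u - sh v) <= nm (u - v).
  have -> : sh u - sh v = cc%:C%C * (u - v) by rewrite /sh; ring.
  by rewrite nmM nm_real ger0_norm // ler_piMl ?nm_ge0.
have sha : sh a = a by rewrite /sh subrr mulr0 addr0.
have sh_in u : nm (u - a) <= s' -> nm (sh u - a) <= s.
  move=> us'; have -> : sh u - a = cc%:C%C * (u - a) by rewrite /sh; ring.
  by rewrite nmM nm_real ger0_norm // -ccs ler_wpM2l.
have sh_near u : nm (u - a) <= s' -> nm (sh u - u) < sigma.
  move=> us'; have -> : sh u - u = - ((1 - cc)%:C%C * (u - a)).
    by rewrite /sh rmorphB rmorph1; ring.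
  rewrite nmN nmM nm_real ger0_norm ?subr_ge0 //; apply: le_lt_trans s's.
  have -> : s' - s = (1 - cc) * s' by rewrite -ccs; ring.
  by rewrite ler_wpM2l // subr_ge0.
have /choice[g' Hg'] : forall u, exists y,
    nm (u - a) <= s' -> F.[y] = u /\ nm (y - g (sh u)) < eta / 4.
  move=> u; case: (leP (nm (u - a)) s') => [us'|]; last by exists 0.
  have [|y Fy yg] := near4 (g (sh u)) u; last by exists y.
  by rewrite gF ?sh_in // sh_near.
have uniq x y : F.[x] = F.[y] -> nm (F.[x] - a) <= r -> nm (x - y) < eta -> x = y.
  move=> xy xr xe; apply/eqP; apply: contraTT xe => nxy.
  by rewrite -leNgt sep.
exists g'; split.
- have := Hg' a; rewrite subrr nm0 sha ga => /(_ s'0)[Fa az0].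
  by apply: uniq; rewrite ?Fa ?Fz0 ?subrr ?nm0 ?(le_trans s'0) //; lra.
- by move=> u us'; case: (Hg' u us').
move=> u us' e e0; have [Fu ug] := Hg' u us'.
have e'0 : 0 < Num.min e (eta / 4) by rewrite lt_min e0; lra.
have [d1 d10 Hd1] := near_ _ e'0.
have [|d2 d20 Hd2] := gc _ (sh_in u us') (eta / 4); first by lra.
exists (Num.min d1 d2); first by rewrite lt_min d10.
move=> v vs'; rewrite lt_min => /andP[vd1 vd2]; have [Fv vg] := Hg' v vs'.
have [|y Fy] := Hd1 (g' u) v; first by rewrite Fu nmBC.
rewrite lt_min => /andP[ye y4].
have gg := Hd2 _ (sh_in v vs') (le_lt_trans (shB _ _) vd2).
suff -> : g' v = y by [].
apply: uniq; rewrite ?Fv ?Fy ?(le_trans vs') //.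
have := nm_dist (g' v) (g (sh v)) y; have := nm_dist (g (sh v)) (g (sh u)) y.
have := nm_dist (g (sh u)) (g' u) y; rewrite (nmBC (g (sh u)) (g' u)) (nmBC (g' u) y).
lra.
Qed.

Lemma exists_section F a z0 r r' : (1 < size F)%N -> 0 <= r -> r < r' ->
  (forall c, F^`().[c] = 0 -> r' <= nm (F.[c] - a)) -> F.[z0] = a ->
  exists g, section_on F a z0 r g.
Proof.
move=> sF r0 rr' Hc Fz0.
have [eta eta0 sep] := preimages_separated sF rr' Hc.
have near_ e : 0 < e -> exists2 d : R, 0 < d &
    forall z w, nm (F.[z] - w) < d -> exists2 y, F.[y] = w & nm (y - z) < e.
  exact: root_near.
have [|sigma sigma0 near4] := near_ (eta / 4); first by lra.
have H k : exists g, section_on F a z0 (Num.min r (k%:R * (sigma / 2))) g.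
  elim: k => [|k [g IH]].
    exists (fun=> z0); rewrite mul0r (min_idPr r0); split => //.
      move=> u u0; rewrite Fz0; apply/esym/eqP; rewrite -subr_eq0 -nm_eq0 eq_le u0.
      exact: nm_ge0.
    by move=> *; exists 1 => // *; rewrite subrr nm0.
  have ks0 : 0 <= k%:R * (sigma / 2) by rewrite mulr_ge0 ?ler0n //; lra.
  have kS : k.+1%:R * (sigma / 2) = k%:R * (sigma / 2) + sigma / 2.
    by rewrite -addn1 natrD mulrDl mul1r.
  apply: section_extend eta0 sep near_ near4 _ _ _ _ rr' Fz0 IH.
  - by rewrite le_min r0.
  - rewrite kS le_min !ge_min lexx /=; apply/orP; right.
    by rewrite lerDl; lra.
  - rewrite kS; case: (leP r (k%:R * (sigma / 2))) => h1;
    case: (leP r (k%:R * (sigma / 2) + sigma / 2)) => h2; lra.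
  - by rewrite ge_min lexx.
have [g Hg] := H (Num.bound (r / (sigma / 2))).
exists g; move: Hg; rewrite (min_idPl _) //.
have s20 : 0 < sigma / 2 by lra.
rewrite -ler_pdivrMr // ltW //; apply: archi_boundP.
by rewrite divr_ge0 // ltW.
Qed.

End Lifting.

(** * Complex derivatives *)

Section Topology.
Variable R : realType.
Local Notation C := (Cplx R).
Local Notation cont h z := {for (z : C), continuous (h : C -> C)}.
Local Notation isd h z l := (is_derive (z : C) (1 : C) (h : C -> C) (l : C)).
Implicit Types (z w l a b v : R[i]) (e d : R) (h g : R[i] -> R[i]).

Lemma gt0_complex (e : R[i]) : 0 < e -> exists2 d : R, 0 < d & e = d%:C%C.
Proof.
case: e => a b; rewrite ltcE /= => /andP[/eqP -> a0].
by exists a.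
Qed.

Lemma nbhs_nmP z (A : set C) :
  nbhs (z : C) A <-> exists2 d : R, 0 < d & forall w, nm (w - z) < d -> A w.
Proof.
split.
  move=> /nbhs_ballP[e /= /gt0_complex[d d0 ->] H]; exists d => // w wz.
  by apply: H; rewrite -ball_normE /ball_ /= distrC normE ltcR.
move=> [d d0 H]; apply/nbhs_ballP; exists d%:C%C; first by rewrite /= ltcR.
by move=> w; rewrite -ball_normE /ball_ /= distrC normE ltcR => /H.
Qed.

Lemma cvg_nmP (T : Type) (F : set_system T) {FF : Filter F} (f : T -> R[i]) l :
  (f x : C) @[x --> F] --> (l : C) <->
  forall e, 0 < e -> \forall x \near F, nm (f x - l) < e.
Proof.
split.
  move=> /cvgrPdist_lt H e e0; have /H : 0 < (e%:C%C : R[i]) by rewrite ltcR.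
  by apply: filterS => x; rewrite normE ltcR nmBC.
move=> H; apply/cvgrPdist_lt => e /gt0_complex[d d0 ->].
by apply: filterS (H d d0) => x; rewrite normE ltcR nmBC.
Qed.

Lemma continuous_nmP h z : cont h z <->
  forall e, 0 < e -> exists2 d, 0 < d & forall w, nm (w - z) < d -> nm (h w - h z) < e.
Proof.
have H := @cvg_nmP _ (nbhs (z : C)) _ h (h z).
split; first by move=> /H hz e /hz /nbhs_nmP.
by move=> hz; apply/H => e /hz /nbhs_nmP.
Qed.

Lemma is_derive_nmP h z l : isd h z l <->
  forall e, 0 < e -> exists2 d, 0 < d & forall v, nm v < d ->
    nm (h (z + v) - h z - l * v) <= e * nm v.
Proof.
split.
  move=> [+ Dl]; rewrite /derivable => /cvg_ex[l' H].
  have {Dl} El : l' = l by rewrite -Dl; apply/esym/cvg_lim.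
  rewrite {l'}El in H.
  move=> e e0; move/cvg_nmP: H => /(_ e e0) /nbhs_nmP[d d0 Hd].
  exists d => // v vd; have [->|v0] := eqVneq v 0.
    by rewrite addr0 subrr mulr0 subr0 nm0 mulr0.
  have := Hd v; rewrite subr0 => /(_ vd v0).
  rewrite /GRing.scale /= mulr1 (addrC v) => /ltW.
  have -> : h (z + v) - h z - l * v = v * (v^-1 * (h (z + v) - h z) - l).
    by rewrite mulrBr mulVKf // (mulrC v).
  by move=> H'; rewrite nmM mulrC ler_pM2r // nm_gt0.
move=> H.
have HH : v^-1 *: ((h (v *: (1 : C) + z) : C) - h z) @[v --> (0 : C)^'] --> (l : C).
  apply/cvg_nmP => e e0; have /H[d d0 Hd] : 0 < e / 2 by lra.
  apply/nbhs_nmP; exists d => // v; rewrite subr0 => vd v0.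
  have := Hd v vd.
  have -> : h (z + v) - h z - l * v = v * (v^-1 *: (h (v *: (1 : C) + z) - h z) - l).
    by rewrite /GRing.scale /= mulr1 (addrC v) mulrBr mulVKf // (mulrC v).
  by rewrite nmM mulrC ler_pM2r ?nm_gt0 // => H'; rewrite (le_lt_trans H') //; lra.
by split; [apply/cvg_ex; exists l | apply/cvg_lim].
Qed.

Lemma is_derive_continuous h z l :
  isd h z l -> cont h z.
Proof.
move=> /is_derive_nmP /(_ 1 ltr01)[d d0 Hd]; apply/continuous_nmP => e e0.
have l0 : 0 < 1 + nm l by rewrite ltr_pwDl // nm_ge0.
exists (Num.min d (e / (1 + nm l))); first by rewrite lt_min d0 divr_gt0.
move=> w; rewrite lt_min => /andP[/Hd]; rewrite [z + _]addrC subrK ltr_pdivlMr // => H1 H2.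
have := nmD (h w - h z - l * (w - z)) (l * (w - z)).
by rewrite subrK nmM; lra.
Qed.

Lemma horner_is_derive (F : {poly R[i]}) z : isd (horner F) z F^`().[z].
Proof.
apply/is_derive_nmP => e e0; have [L L0 HL] := poly_taylor1 F (nm z + 1).
exists (Num.min 1 (e / L)); first by rewrite lt_min ltr01 divr_gt0.
move=> v; rewrite lt_min => /andP[v1]; rewrite ltr_pdivlMr // => vL.
have := HL z (z + v); have := nmD z v; have vz : z + v - z = v by rewrite addrC addKr.
rewrite vz => h1 /(_ _ _)/le_trans; apply; rewrite ?expr2; try lra.
by rewrite mulrA ler_wpM2r ?nm_ge0 // mulrC ltW.
Qed.

Lemma horner_continuous (F : {poly R[i]}) z : cont (horner F) z.
Proof. by apply: is_derive_continuous (horner_is_derive F z). Qed.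

Lemma is_derive_affine a b z : isd (fun u : R[i] => a + b * u) z b.
Proof.
apply/is_derive_nmP => e e0; exists 1 => // v _.
have -> : a + b * (z + v) - (a + b * z) - b * v = 0 by ring.
by rewrite nm0 mulr_ge0 ?nm_ge0 // ltW.
Qed.

Lemma is_derive_comp_affine h a b z l :
  isd h (a + b * z) l ->
  isd (fun u : R[i] => h (a + b * u)) z (b * l).
Proof.
move=> /is_derive_nmP H; apply/is_derive_nmP => e e0.
have b0 : 0 < 1 + nm b by rewrite ltr_pwDl // nm_ge0.
have /H[d d0 Hd] : 0 < e / (1 + nm b) by rewrite divr_gt0.
exists (d / (1 + nm b)); first by rewrite divr_gt0.
move=> v; rewrite ltr_pdivlMr // => vd.
have := Hd (b * v); have -> : a + b * z + b * v = a + b * (z + v) by ring.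
have -> : l * (b * v) = b * l * v by ring.
rewrite nmM => /(_ _)/le_trans; apply; first by have := nm_ge0 v; lra.
rewrite mulrA ler_wpM2r ?nm_ge0 // mulrAC ler_pdivrMr // ler_wpM2l ?(ltW e0) //.
by rewrite lerDr.
Qed.

Lemma continuous_comp_affine h a b z :
  cont h (a + b * z) -> cont (fun u : R[i] => h (a + b * u)) z.
Proof.
move=> /continuous_nmP H; apply/continuous_nmP => e /H[d d0 Hd].
have /continuous_nmP/(_ d d0)[d' d'0 Hd'] :=
  is_derive_continuous (is_derive_affine a b z).
by exists d' => // w /Hd'; exact: Hd.
Qed.

Lemma is_derive_inverse_poly (F : {poly R[i]}) g z (r : R) : 0 < r ->
  (forall u, nm (u - z) < r -> F.[g u] = u) -> cont g z ->
  F^`().[g z] != 0 -> isd g z (F^`().[g z])^-1.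
Proof.
move=> r0 Fg /continuous_nmP gc D0; have m0 : 0 < nm F^`().[g z] by rewrite nm_gt0.
set m := nm _ in m0; set D := _.[_] in m D0 m0 *.
have [L L0 HL] := poly_taylor1 F (nm (g z) + 1).
apply/is_derive_nmP => e e0.
pose t := Num.min 1 (Num.min (m / (2 * L)) (e * m ^+ 2 / (2 * L))).
have t0 : 0 < t by rewrite !lt_min ltr01 !divr_gt0 ?mulr_gt0 ?exprn_gt0.
have [d d0 Hd] := gc t t0.
exists (Num.min d r); first by rewrite lt_min d0.
move=> v; rewrite lt_min => /andP[vd vr].
have zv : z + v - z = v by rewrite addrC addKr.
have := Hd (z + v); rewrite zv => /(_ vd).
set y := g (z + v); set k := nm (y - g z); rewrite !lt_min => /and3P[k1 k2 k3].
have k0 : 0 <= k by exact: nm_ge0.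
have yM : nm y <= nm (g z) + 1 by have := nm_lB y (g z); rewrite -/k; lra.
have gzM : nm (g z) <= nm (g z) + 1 by lra.
have Fz : F.[g z] = z by rewrite Fg // subrr nm0.
have Fy : F.[y] = z + v by rewrite Fg // zv.
have := HL (g z) y gzM yM; rewrite Fz Fy zv -/D -/k => H1.
have H2 : m * k <= 2 * nm v.
  have := nmD (v - D * (y - g z)) (D * (y - g z) - v).
  have := nm_lB (D * (y - g z)) v; rewrite (nmBC _ v) nmM -/m -/k.
  move: k2; rewrite ltr_pdivlMr ?mulr_gt0 // => k2.
  have : L * k ^+ 2 <= m * k / 2.
    rewrite expr2 mulrA; have : k * (2 * L) * k <= m * k by rewrite ler_wpM2r // ltW.
    lra.
  lra.
have -> : y - g z - D^-1 * v = - (D^-1 * (v - D * (y - g z))).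
  by rewrite mulrBr mulKf // opprB.
rewrite nmN nmM nmV -/m mulrC ler_pdivrMr //; apply: le_trans H1 _.
move: k3; rewrite ltr_pdivlMr ?mulr_gt0 // => k3.
rewrite -(ler_pM2r m0); apply: (@le_trans _ _ (L * k * (2 * nm v))).
  by rewrite expr2 -mulrA -mulrA ler_pM2l // -mulrA ler_wpM2l // (mulrC k).
have : k * (2 * L) * nm v <= e * m ^+ 2 * nm v by rewrite ler_wpM2r ?nm_ge0 // ltW.
rewrite expr2; lra.
Qed.

End Topology.

(** * Length of chains of disks *)

Section Curves.
Variable R : realType.
Local Notation C := (Cplx R).
Local Notation cont h z := {for (z : C), continuous (h : C -> C)}.
Local Notation isd h z l := (is_derive (z : C) (1 : C) (h : C -> C) (l : C)).
Local Notation contR phi t := {for (t : R), continuous (phi : R -> C)}.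
Implicit Types (phi : R -> R[i]) (t s e al be : R) (h : R[i] -> R[i]).

Lemma curve_continuous_nmP phi t : contR phi t <->
  forall e, 0 < e -> \forall s \near t, nm (phi s - phi t) < e.
Proof. exact: (@cvg_nmP _ _ (nbhs t) _ phi (phi t)). Qed.

Lemma nbhs_realP t (A : set R) :
  nbhs t A <-> exists2 d : R, 0 < d & forall s, `|s - t| < d -> A s.
Proof.
split.
  move=> /nbhs_ballP[d d0 H]; exists d => // s st; apply: H.
  by rewrite -ball_normE /ball_ /= distrC.
move=> [d d0 H]; apply/nbhs_ballP; exists d => // s.
by rewrite -ball_normE /ball_ /= distrC => /H.
Qed.

Lemma curve_continuous_comp h (theta : R -> R) t :
  {for t, continuous theta} -> cont h (theta t)%:C%C ->
  contR (fun s => h (theta s)%:C%C) t.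
Proof.
move=> ct /continuous_nmP H; apply/curve_continuous_nmP => e /H[d d0 Hd].
have /(@cvgrPdist_lt _ _ _ (nbhs t))/(_ d d0) := ct.
apply: (@filterS _ (nbhs t)) => s; rewrite distrC => Hs.
by apply: Hd; rewrite -rmorphB nm_real.
Qed.

Lemma curve_continuous_sum (n : nat) (psi : nat -> R -> R[i]) (c : nat -> R[i]) t :
  (forall i, (i < n)%N -> contR (psi i) t) ->
  contR (fun s => c 0%N + \sum_(i < n) (psi i s - c i)) t.
Proof.
elim: n => [|n IH] H; apply/curve_continuous_nmP => e e0.
  by apply/nbhs_realP; exists 1 => // s _; rewrite !big_ord0 subrr nm0.
have e20 : 0 < e / 2 by lra.
have /curve_continuous_nmP/(_ _ e20) := IH (fun i ni => H i (ltnW ni)).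
have /curve_continuous_nmP/(_ _ e20) := H n (ltnSn n).
apply: (@filterS2 _ (nbhs t)) => s H1 H2; rewrite !big_ord_recr /=.
set S := \sum_(i < n) _ in H2 *; set T := \sum_(i < n) _ in H2 *.
have -> : c 0%N + (S + (psi n s - c n)) - (c 0%N + (T + (psi n t - c n))) =
  (c 0%N + S - (c 0%N + T)) + (psi n s - psi n t) by ring.
by apply: le_lt_trans (nmD _ _) _; lra.
Qed.

Lemma is_derive_realP (f : R -> R) t l :
  (forall e, 0 < e -> \forall v \near (0 : R), `|f (t + v) - f t - v * l| <= e * `|v|) ->
  is_derive t (1 : R) f l.
Proof.
move=> H.
have HH : v^-1 *: (f (v *: (1 : R) + t) - f t) @[v --> (0 : R)^'] --> l.
  apply/cvgrPdist_lt => e e0; have e20 : 0 < e / 2 by lra.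
  rewrite /dnbhs /within; near_simpl; apply: (@filterS _ (nbhs (0 : R))) (H _ e20) => v Hv v0.
  rewrite -(ltr_pM2l (_ : 0 < `|v|)) ?normr_gt0 // -normrM mulrC.
  have -> : (l - v^-1 *: (f (v *: (1 : R) + t) - f t)) * v = - (f (t + v) - f t - v * l).
    rewrite /GRing.scale /= mulr1 (addrC v) mulrBl mulrAC mulVf // mul1r; ring.
  rewrite normrN; apply: le_lt_trans Hv _; rewrite mulrC ltr_pM2l ?normr_gt0 //; lra.
by split; [apply/cvg_ex; exists l | apply/cvg_lim].
Qed.

Lemma curve_deriveP phi t (l : R[i]) :
  (forall e, 0 < e -> \forall v \near (0 : R),
    nm (phi (t + v) - phi t - v%:C%C * l) <= e * `|v|) ->
  curve_derivable phi t /\ curve_derive phi t = l.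
Proof.
move=> H.
have ReB (x y : R[i]) : complex.Re (x - y) = complex.Re x - complex.Re y.
  by case: x; case: y.
have ImB (x y : R[i]) : complex.Im (x - y) = complex.Im x - complex.Im y.
  by case: x; case: y.
have dRe : is_derive t (1 : R) (fun s => complex.Re (phi s)) (complex.Re l).
  apply: is_derive_realP => e /H; apply: (@filterS _ (nbhs (0 : R))) => v; apply: le_trans.
  have -> : v * complex.Re l = complex.Re (v%:C%C * l).
    by case: l {H} => a b /=; rewrite mul0r subr0.
  by rewrite -!ReB nm_Re.
have dIm : is_derive t (1 : R) (fun s => complex.Im (phi s)) (complex.Im l).
  apply: is_derive_realP => e /H; apply: (@filterS _ (nbhs (0 : R))) => v; apply: le_trans.
  have -> : v * complex.Im l = complex.Im (v%:C%C * l).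
    by case: l {H dRe} => a b /=; rewrite mul0r addr0.
  by rewrite -!ImB nm_Im.
split; first by split; apply: ex_derive.
by rewrite /curve_derive !derive1E !derive_val; case: l {H dRe dIm}.
Qed.

Lemma curve_derive_affine h phi al be t (l : R[i]) :
  isd h (al + be * t)%:C%C l ->
  (\forall s \near t, phi s = h (al + be * s)%:C%C) ->
  curve_derivable phi t /\ curve_derive phi t = be%:C%C * l.
Proof.
move=> hl /nbhs_realP[d0 d00 near_phi]; apply: curve_deriveP => e e0.
have pt : phi t = h (al + be * t)%:C%C by apply: near_phi; rewrite subrr normr0.
have /is_derive_nmP/(_ e e0)[d dgt0 Hd] :
    isd (fun u : R[i] => h (al%:C%C + be%:C%C * u)) t%:C%C (be%:C%C * l).
  by apply: is_derive_comp_affine; rewrite -rmorphM -rmorphD.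
apply/nbhs_realP; exists (Num.min d0 d); first by rewrite lt_min d00.
move=> v; rewrite subr0 lt_min => /andP[v0 vd].
have -> : phi (t + v) = h (al + be * (t + v))%:C%C.
  by apply: near_phi; rewrite (addrC t) addrK.
rewrite pt (mulrC v%:C%C); have := Hd v%:C%C; rewrite nm_real => /(_ vd).
have affE s : al%:C%C + be%:C%C * s%:C%C = (al + be * s)%:C%C :> R[i].
  by rewrite rmorphD rmorphM.
by rewrite -[(t%:C + v%:C)%C]rmorphD !affE.
Qed.

End Curves.

Section Chains.
Variable R : realType.
Local Notation C := (Cplx R).
Local Notation cont h z := {for (z : C), continuous (h : C -> C)}.
Local Notation isd h z l := (is_derive (z : C) (1 : C) (h : C -> C) (l : C)).
Local Notation mu := (@lebesgue_measure R).
Implicit Types (U : set C) (h dh : R[i] -> R[i]) (u v z w : R[i]).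

(* Piecewise smooth curves need a continuous derivative; requiring it here spares
   us Goursat's theorem. *)
Definition C1_disk U h dh := forall u, nm u < 1 -> [/\ U (h u), isd h u (dh u) & cont dh u].

Definition link U z w := exists h dh, [/\ C1_disk U h dh, h 0 = z & h (2^-1)%:C%C = w].

Definition chain U k z w := exists c : nat -> R[i],
  [/\ c 0%N = z, c k = w & forall i, (i < k)%N -> link U (c i) (c i.+1)].

Lemma kobayashi_metric_ge0 U (z xi : C) : (0 <= kobayashi_metric U z xi)%E.
Proof. by apply/ereal_infP => _ [lam [lam0 _] <-]; rewrite lee_fin ltW. Qed.

Lemma kobayashi_metric_le U h dh u v (lam : R) : C1_disk U h dh ->
  nm u <= 2^-1 -> 0 < lam -> 2 * nm v <= lam ->
  (kobayashi_metric U (h u : C) (v * dh u : R[i])%R <= lam%:E)%E.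
Proof.
move=> hU u2 lam0 vlam; apply: ereal_inf_lbound; exists lam => //; split => //.
pose b : R[i] := v / lam%:C%C.
have lamN0 : (lam%:C%C : R[i]) != 0.
  by rewrite -nm_eq0 nm_real normr_eq0 gt_eqF.
have b2 : nm b <= 2^-1.
  rewrite /b nmM nmV nm_real gtr0_norm // ler_pdivrMr //; lra.
have disk t : nm t < 1 -> nm (u + b * t) < 1.
  move=> t1; apply: le_lt_trans (nmD _ _) _; rewrite nmM.
  have := nm_ge0 b; have := nm_ge0 t => t0 b0.
  have : nm b * nm t <= 2^-1 * nm t by rewrite ler_wpM2r.
  lra.
have dh0 t : nm t < 1 -> isd (fun t : R[i] => h (u + b * t)) t (b * dh (u + b * t)).
  by move=> /disk/hU[_ ? _]; exact: is_derive_comp_affine.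
exists (fun t : R[i] => h (u + b * t)); split.
- move=> t; rewrite normE ltcR => t1; split.
    by have [] := dh0 t t1.
  by have [] := hU _ (disk t t1).
- by rewrite mulr0 addr0.
have := dh0 0; rewrite nm0 mulr0 addr0 => /(_ ltr01)[_].
rewrite derive1E => ->; rewrite /b mulrA mulrCA; congr (_ * _).
by rewrite mulfV // mulr1.
Qed.

Lemma integral_le_countable (g : R -> \bar R) (S : set R) (M : R) :
  0 <= M -> countable S -> (forall t, 0 <= g t)%E ->
  (forall t, 0 <= t <= 1 -> ~ S t -> (g t <= M%:E)%E) ->
  (\int[mu]_(t in `[0%R, 1%R]%classic) g t <= M%:E)%E.
Proof.
move=> M0 cS g0 gM.
pose G t : \bar R := if t \in S then +oo%E else M%:E.
have mS : measurable S by apply: countable_measurable.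
have mI : measurable (`[0%R, 1%R]%classic : set R) by exact: measurable_itv.
have G0 t : (0 <= G t)%E by rewrite /G; case: ifP => // _; rewrite lee_fin.
have mG : measurable_fun setT G.
  apply: measurable_fun_ifT => //.
  apply: (measurable_fun_bool true); rewrite setTI [X in measurable X](_ : _ = S) //.
  by apply/seteqP; split => t /=; [move/set_mem | move/mem_set].
apply: (@le_trans _ _ (\int[mu]_(t in `[0%R, 1%R]%classic) G t)%E).
  rewrite !ge0_integralE //; apply: ereal_sup_le => x [h hg <-].
  exists h => // t; apply: le_trans (hg t) _.
  rewrite /patch; case: ifP => //; rewrite inE /= in_itv /= => t01.
  rewrite /G; case: ifPn => [|/negP tS]; first by rewrite leey.
  by apply: gM => // ?; apply: tS; rewrite inE.
rewrite (@ge0_ae_eq_integral _ _ _ mu _ G (cst M%:E)) //.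
- rewrite integral_cst //= lebesgue_measure_itv /= lte_fin ltr01.
  by rewrite oppr0 adde0 mule1.
- exact: measurable_funS mG.
exists S; split => //; first exact: countable_lebesgue_measure0.
move=> t /= /not_implyP[_]; rewrite /G; case: ifPn => [|_ //].
by rewrite inE.
Qed.

End Chains.

Section ChainLength.
Variable R : realType.
Local Notation C := (Cplx R).
Local Notation contR phi t := {for (t : R), continuous (phi : R -> C)}.
Implicit Types (U : set C) (t x : R) (z w : R[i]).

Definition clamp01 x : R := Num.max 0 (Num.min 1 x).

Lemma clamp01_in x : 0 <= x <= 1 -> clamp01 x = x.
Proof. by move=> /andP[x0 x1]; rewrite /clamp01 (min_idPr x1) (max_idPr x0). Qed.

Lemma clamp01_le0 x : x <= 0 -> clamp01 x = 0.
Proof.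
by move=> x0; rewrite /clamp01 (min_idPr (le_trans x0 ler01)) (max_idPl x0).
Qed.

Lemma clamp01_ge1 x : 1 <= x -> clamp01 x = 1.
Proof. by move=> x1; rewrite /clamp01 (min_idPl x1) (max_idPr ler01). Qed.

Lemma clamp01_itv x : 0 <= clamp01 x <= 1.
Proof.
have [x0|/ltW x0] := leP x 0; first by rewrite clamp01_le0 // lexx ler01.
have [x1|/ltW x1] := leP 1 x; first by rewrite clamp01_ge1 // lexx ler01.
by rewrite clamp01_in ?x0.
Qed.

Lemma continuous_real_affine a b t : {for t, continuous (fun s : R => a + b * s)}.
Proof.
by apply: cvgD; [exact: cvg_cst|apply: cvgM; [exact: cvg_cst|exact: cvg_id]].
Qed.

Lemma continuous_clamp_affine a b t :
  {for t, continuous (fun s : R => clamp01 (a * s - b) / 2)}.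
Proof.
have ca : {for t, continuous (fun s : R => a * s - b)}.
  by apply: cvgB; [apply: cvgM; [exact: cvg_cst|exact: cvg_id]|exact: cvg_cst].
apply: cvgM; last exact: cvg_cst.
apply: (@continuous_max R R (fun=> 0) (fun s => Num.min 1 (a * s - b))).
  exact: cvg_cst.
apply: (@continuous_min R R (fun=> 1) (fun s => a * s - b)) => //.
exact: cvg_cst.
Qed.

Lemma nat_floor_bounds (n : nat) x : 0 <= x <= n.+1%:R ->
  exists2 j, (j < n.+1)%N & j%:R <= x <= j.+1%:R.
Proof.
elim: n => [|n IH] /andP[x0 xn]; first by exists 0%N; rewrite ?x0.
have [xl|/ltW xl] := leP x n.+1%:R.
  by have [|j jn jx] := IH; [rewrite x0|exists j; rewrite // ltnS ltnW].
by exists n.+1; rewrite ?xl.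
Qed.

(* All disks are run through at once, the parameter of the [i]-th one being
   clamped: the sum telescopes, and its continuity needs no gluing. *)
Definition chain_curve n (h : nat -> R[i] -> R[i]) (c : nat -> R[i]) t : R[i] :=
  c 0%N + \sum_(i < n) (h i (clamp01 (n%:R * t - i%:R) / 2)%:C%C - c i).

Lemma continuous_mulc (a : R[i]) (g : R[i] -> R[i]) (u : R[i]) :
  {for (u : C), continuous (g : C -> C)} ->
  {for (u : C), continuous ((fun v => a * g v) : C -> C)}.
Proof.
move=> /continuous_nmP H; apply/continuous_nmP => e e0.
have a0 : 0 < 1 + nm a by rewrite ltr_pwDl ?nm_ge0.
have /H[d d0 Hd] : 0 < e / (1 + nm a) by rewrite divr_gt0.
exists d => // w /Hd; rewrite -mulrBr nmM ltr_pdivlMr // => {}Hd.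
by have := nm_ge0 (g w - g u); lra.
Qed.

Section Curve.
Variables (U : set C) (n : nat) (h dh : nat -> R[i] -> R[i]) (c : nat -> R[i]).
Hypothesis hU : forall i, (i < n)%N -> C1_disk U (h i) (dh i).
Hypothesis h0 : forall i, (i < n)%N -> h i 0 = c i.
Hypothesis h1 : forall i, (i < n)%N -> h i (2^-1)%:C%C = c i.+1.
Local Notation gamma := (chain_curve n h c).

Lemma chain_curveE j t : (j < n)%N -> j%:R <= n%:R * t <= j.+1%:R ->
  gamma t = h j (- (j%:R / 2) + n%:R / 2 * t)%:C%C.
Proof.
move=> jn /andP[jt tj]; set y := h j _.
suff H m : (m <= n)%N ->
    \sum_(i < m) (h i (clamp01 (n%:R * t - i%:R) / 2)%:C%C - c i) =
      if (m <= j)%N then c m - c 0%N else y - c 0%N.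
  by rewrite /chain_curve H // leqNgt jn /= addrC subrK.
elim: m => [|m IH] mn; first by rewrite big_ord0 subrr.
rewrite big_ord_recr /= IH ?(ltnW mn) //.
case: (ltngtP m j) => mj.
- rewrite clamp01_ge1 ?mul1r ?h1 //; first by ring.
  by rewrite lerBrDr; apply: le_trans jt; rewrite addrC natr1 ler_nat.
- rewrite clamp01_le0 ?mul0r ?h0 ?subrr ?addr0 // lerBlDr add0r.
  by apply: le_trans tj _; rewrite ler_nat.
rewrite mj clamp01_in; last by rewrite subr_ge0 jt lerBlDr addrC natr1.
have -> : (n%:R * t - j%:R) / 2 = - (j%:R / 2) + n%:R / 2 * t by lra.
by rewrite -/y; ring.
Qed.

Lemma chain_curve_continuous t : contR gamma t.
Proof.
pose theta i (s : R) := clamp01 (n%:R * s - i%:R) / 2.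
apply: (@curve_continuous_sum R n (fun i s => h i (theta i s)%:C%C) c t) => i ni.
apply: (@curve_continuous_comp R (h i) (theta i)).
  exact: continuous_clamp_affine.
have /andP[x0 x1] := clamp01_itv (n%:R * t - i%:R).
have [|_ hd _] := hU ni (u := (clamp01 (n%:R * t - i%:R) / 2)%:C%C).
  rewrite nm_real ger0_norm; lra.
exact: is_derive_continuous hd.
Qed.

End Curve.

Lemma kobayashi_dist_chain U n z w : (0 < n)%N -> chain U n z w ->
  (kobayashi_dist U (z : C) (w : C) <= n%:R%:E)%E.
Proof.
move=> n0 [c [<- <- cl]].
have /choice[hd Hhd] : forall i, exists hd : (R[i] -> R[i]) * (R[i] -> R[i]),
    (i < n)%N -> [/\ C1_disk U hd.1 hd.2, hd.1 0 = c i & hd.1 (2^-1)%:C%C = c i.+1].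
  move=> i; case: (ltnP i n) => [/cl[h [dh H]]|]; last by exists (id, id).
  by exists (h, dh).
pose h i := (hd i).1; pose dh i := (hd i).2.
have hU i : (i < n)%N -> C1_disk U (h i) (dh i) by move=> /Hhd[].
have h0 i : (i < n)%N -> h i 0 = c i by move=> /Hhd[].
have h1 i : (i < n)%N -> h i (2^-1)%:C%C = c i.+1 by move=> /Hhd[].
pose gamma := chain_curve n h c.
have K0 : 0 < n%:R :> R by rewrite ltr0n.
have KN0 : n%:R != 0 :> R by rewrite gt_eqF.
have gE j t : (j < n)%N -> j%:R <= n%:R * t <= j.+1%:R ->
    gamma t = h j (- (j%:R / 2) + n%:R / 2 * t)%:C%C.
  exact: (chain_curveE h0 h1).
pose p j t : R[i] := (- (j%:R / 2) + n%:R / 2 * t)%:C%C.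
have p2 j t : j%:R <= n%:R * t <= j.+1%:R -> nm (p j t) <= 2^-1.
  rewrite -natr1 => /andP[jt tj]; rewrite /p nm_real ger0_norm; lra.
have pieces t : 0 <= t <= 1 -> exists2 j, (j < n)%N & j%:R <= n%:R * t <= j.+1%:R.
  move=> /andP[t0 t1]; case: n n0 K0 {KN0 cl Hhd hU h0 h1 gamma gE p p2} => // m _ K0.
  by apply: nat_floor_bounds; apply/andP; split; [rewrite mulr_ge0 | rewrite ler_piMr].
have gd j t : (j < n)%N -> j%:R < n%:R * t < j.+1%:R ->
    curve_derivable gamma t /\ curve_derive gamma t = (n%:R / 2)%:C%C * dh j (p j t).
  move=> jn /andP[jt tj]; apply: (@curve_derive_affine R (h j) gamma (- (j%:R / 2))).
    have [|_ ? _] := hU j jn (p j t); last by [].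
    by apply: le_lt_trans (p2 j t _) _; [rewrite !ltW | lra].
  have d0 : 0 < Num.min (n%:R * t - j%:R) (j.+1%:R - n%:R * t) / n%:R.
    by rewrite divr_gt0 // lt_min !subr_gt0 jt.
  apply/nbhs_realP; eexists; first exact: d0.
  move=> s; rewrite ltr_pdivlMr // lt_min => /andP[s1 s2]; apply: gE => //.
  have : `|n%:R * s - n%:R * t| = `|s - t| * n%:R.
    by rewrite -mulrBr normrM gtr0_norm // mulrC.
  move=> sE; rewrite -!sE in s1 s2.
  have s3 := ler_norm (n%:R * s - n%:R * t); have s4 := ler_norm (n%:R * t - n%:R * s).
  by rewrite distrC in s4; apply/andP; split; lra.
apply: (@le_trans _ _ (kobayashi_length U gamma)).
  apply: ereal_inf_lbound; exists gamma => //; split.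
  - split.
      apply: continuous_in_subspaceT => t _.
      exact (@chain_curve_continuous U n h dh c hU t).
    pose s : seq R := mkseq (fun i => i.+1%:R / n%:R) n.
    have sn i : (i <= n)%N -> nth 1 (0 :: s) i = i%:R / n%:R.
      by case: i => [|i] ni; rewrite ?mul0r //= nth_mkseq.
    exists s.
      split; last first.
        by rewrite -nth_last size_mkseq nth_mkseq ?prednK ?divff.
      apply/(pathP 1) => i; rewrite size_mkseq => ni.
      rewrite sn ?(ltnW ni) // nth_mkseq // ltr_pM2r ?invr_gt0 // ltr_nat //.
    move=> i; rewrite size_mkseq => ni a b; rewrite /a /b (sn i) ?(ltnW ni) // (sn i.+1) //.
    exists (fun t => (n%:R / 2)%:C%C * dh i (p i t)); split.
      apply: continuous_in_subspaceT => t; rewrite inE /= in_itv /= => tab.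
      have it : i%:R <= n%:R * t <= i.+1%:R.
        by move: tab; rewrite ler_pdivrMr // ler_pdivlMr // mulrC.
      apply: (@curve_continuous_comp R (fun u => (n%:R / 2)%:C%C * dh i u)
        (fun t => - (i%:R / 2) + n%:R / 2 * t)).
        exact: continuous_real_affine.
      have [|_ _ dc] := hU i ni (p i t).
        by apply: le_lt_trans (p2 i t it) _; lra.
      exact: continuous_mulc.
    move=> t; rewrite ltr_pdivrMr // ltr_pdivlMr // mulrC => it.
    exact: gd.
  - move=> t /pieces[j jn jt]; rewrite (gE j t jn jt).
    by have [|] := hU j jn (p j t); first by apply: le_lt_trans (p2 j t jt) _; lra.
  - rewrite (gE 0%N) // ?mulr0 ?lexx ?ler0n // mul0r oppr0 addr0 h0 //.
  - have n1n : (n.-1 < n)%N by rewrite prednK.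
    rewrite (gE n.-1) // ?prednK // ?mulr1 ?lexx ?ler_nat ?leq_pred //.
    have -> : - (n.-1%:R / 2) + n%:R / 2 = 2^-1 :> R.
      by rewrite -[in n%:R](prednK n0) -natr1; lra.
    by rewrite h1 // prednK.
apply: (@integral_le_countable _ _ [set i%:R / n%:R | i in [set: nat]]).
- exact: ltW.
- exact: card_image_le.
- by move=> t; exact: kobayashi_metric_ge0.
move=> t /pieces[j jn /andP[]]; rewrite le_eqVlt => /orP[/eqP jt|jt].
  by move=> _ []; exists j => //; rewrite jt mulrAC divff // mul1r.
rewrite le_eqVlt => /orP[/eqP tj|tj].
  by case; exists j.+1 => //; rewrite -tj mulrAC divff // mul1r.
move=> _; have [|_ ->] := gd j t jn; first by rewrite jt.
have jt' : j%:R <= n%:R * t <= j.+1%:R by rewrite !ltW.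
rewrite (gE j t jn jt'); apply: kobayashi_metric_le (hU j jn) (p2 j t jt') K0 _.
by rewrite nm_real ger0_norm ?divr_ge0 ?ler0n // mulrC divfK.
Qed.

End ChainLength.

(** * Pulling back disks by iterates *)

Section ChainTheory.
Variable R : realType.
Local Notation C := (Cplx R).
Local Notation cont h z := {for (z : C), continuous (h : C -> C)}.
Implicit Types (U : set C) (z w q : R[i]).

Lemma link_refl U z : U z -> link U z z.
Proof.
move=> Uz; exists (fun=> z), (fun=> 0); split=> // u _; split=> //.
  by apply/is_derive_nmP => e e0; exists 1 => // v _;
    rewrite subrr mul0r subr0 nm0 mulr_ge0 ?nm_ge0 // ltW.
by apply/continuous_nmP => e e0; exists 1 => // w _; rewrite subrr nm0.
Qed.

Lemma chain_cons U k z w q : link U z w -> chain U k w q -> chain U k.+1 z q.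
Proof.
move=> zw [c [c0 ck cl]]; exists (fun i => if i is j.+1 then c j else z).
by split=> // -[_|i]; [rewrite c0|exact: cl].
Qed.

Lemma chain_refl U z : chain U 0 z z.
Proof. by exists (fun=> z). Qed.

Lemma chain_pad U k k' z q : (k <= k')%N -> U q -> chain U k z q -> chain U k' z q.
Proof.
move=> kk' Uq [c [c0 ck cl]]; exists (fun i => c (minn i k)); split.
- by rewrite min0n.
- by rewrite (minn_idPr kk').
move=> i _ /=; case: (leqP k i) => ki.
  by rewrite (minn_idPr (leqW ki)) ck; exact: link_refl.
by rewrite (minn_idPl ki); exact: cl.
Qed.

Lemma continuous_inv h z : cont h z -> h z != 0 -> cont (fun u : R[i] => (h u)^-1) z.
Proof. by move=> hz h0; exact: (cvgV h0 hz). Qed.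

End ChainTheory.

Section Dynamics.
Variables (R : realType) (f : {poly R[i]}) (p : R[i]).
Hypothesis f_size : (1 < size f)%N.
Hypothesis f_attr : attracting_fixed_point f p.
Local Notation C := (Cplx R).
Local Notation cont h z := {for (z : C), continuous (h : C -> C)}.
Local Notation isd h z l := (is_derive (z : C) (1 : C) (h : C -> C) (l : C)).
Implicit Types (n m k : nat) (x y z w c q u : R[i]) (e r : R).

Local Notation it n := (iter n (horner f)).
Local Notation A := (basin f p : set C).

Definition iter_poly n : {poly R[i]} := iter n (fun g => f \Po g) 'X.

Lemma horner_iter_poly n z : (iter_poly n).[z] = it n z.
Proof. by elim: n => [|n IH]; rewrite /= ?hornerX // horner_comp IH. Qed.

Lemma size_iter_poly n : (1 < size (iter_poly n))%N.
Proof.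
elim: n => [|n IH]; first by rewrite /= size_polyX.
have : (0 < (size (iter_poly n.+1)).-1)%N.
  by rewrite /= size_comp_poly muln_gt0 -!subn1 !subn_gt0 f_size.
by case: (size _) => [|[]].
Qed.

Definition postcritical w := exists c m, f^`().[c] = 0 /\ w = it m.+1 c.

Lemma critical_value_postcritical n c :
  (iter_poly n)^`().[c] = 0 -> postcritical (iter_poly n).[c].
Proof.
elim: n => [|n IH]; first by rewrite /= derivX hornerC => /eqP; rewrite oner_eq0.
rewrite /= deriv_comp hornerM horner_comp => /eqP.
rewrite mulf_eq0 horner_comp => /orP[/eqP H|/eqP/IH[c' [m [c'0 ->]]]].
  by exists (iter_poly n).[c], 0%N.
by exists c', m.+1.
Qed.

Lemma basinP z : A z <->
  forall e, 0 < e -> exists N, forall n, (N <= n)%N -> nm (it n z - p) < e.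
Proof.
have H := @cvg_nmP _ nat \oo _ (fun n => it n z) p.
split.
  by move=> /H h e /h [N _ HN]; exists N => n Nn; apply: HN.
by move=> h; apply/H => e /h [N HN]; exists N.
Qed.

Lemma iter_fixed n : it n p = p.
Proof. by elim: n => //= n ->; case: f_attr. Qed.

Lemma basin_preimage z : A f.[z] <-> A z.
Proof.
split=> /basinP H; apply/basinP => e /H[N HN].
  by exists N.+1 => -[|n] // Nn; rewrite iterSr; exact: HN.
by exists N => n Nn; rewrite -iterSr; apply: HN; exact: leqW.
Qed.

Lemma basin_iter n z : A (it n z) <-> A z.
Proof. by elim: n => //= n IH; rewrite basin_preimage. Qed.

Lemma basin_fixed : A p.
Proof. by apply/basinP => e e0; exists 0%N => n _; rewrite iter_fixed subrr nm0. Qed.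

Lemma basin_iter_preimage n z : it n z = p -> A z.
Proof. by move=> nz; apply/(basin_iter n); rewrite nz; exact: basin_fixed. Qed.

Lemma attracting_disk : exists2 r, 0 < r & forall z, nm (z - p) < r ->
  A z /\ nm (f.[z] - p) <= nm (z - p).
Proof.
have [fp] := f_attr; rewrite normE ltcR; set m := nm _ => m1.
have m0 : 0 <= m by exact: nm_ge0.
pose lam := (1 + m) / 2; have lam0 : 0 <= lam by rewrite /lam; lra.
have lam1 : lam < 1 by rewrite /lam; lra.
have e0 : 0 < (1 - m) / 2 by lra.
have /is_derive_nmP/(_ _ e0)[d d0 Hd] := horner_is_derive f p.
have fz z : nm (z - p) < d -> nm (f.[z] - p) <= lam * nm (z - p).
  move=> /Hd; rewrite [p + _]addrC subrK fp => H.
  have := nmD (f.[z] - p - f^`().[p] * (z - p)) (f^`().[p] * (z - p)).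
  by rewrite subrK nmM -/m /lam; lra.
exists d => // z zd; split; last first.
  by apply: le_trans (fz z zd) _; rewrite ler_piMl ?nm_ge0 // ltW.
have itz n : nm (it n z - p) <= lam ^+ n * nm (z - p).
  elim: n => [|n IH]; first by rewrite expr0 mul1r.
  have itd : nm (it n z - p) < d.
    apply: le_lt_trans IH _; apply: le_lt_trans zd.
    by rewrite ler_piMl ?nm_ge0 // exprn_ile1 // ltW.
  by apply: le_trans (fz _ itd) _; rewrite exprS -mulrA ler_wpM2l.
apply/basinP => e egt0.
have ed : 0 < e / d by rewrite divr_gt0.
have lam_to0 : (fun n => lam ^+ n) @ \oo --> (0 : R).
  by apply: cvg_expr; rewrite ger0_norm.
have [N _ HN] := (@cvgrPdist_lt R R nat \oo _ (fun n => lam ^+ n) 0).1 lam_to0 _ ed.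
exists N => n /HN /=; rewrite sub0r normrN ger0_norm ?exprn_ge0 // ltr_pdivlMr // => H.
apply: le_lt_trans (itz n) _; apply: le_lt_trans H.
by rewrite ler_wpM2l ?exprn_ge0 // ltW.
Qed.

Lemma iter_continuous n z e : 0 < e ->
  exists2 d : R, 0 < d & forall w, nm (w - z) < d -> nm (it n w - it n z) < e.
Proof.
move=> e0; have /continuous_nmP/(_ e e0)[d d0 Hd] := @horner_continuous R (iter_poly n) z.
by exists d => // w /Hd; rewrite !horner_iter_poly.
Qed.

Lemma basin_open z : A z -> exists2 e, 0 < e & forall w, nm (w - z) < e -> A w.
Proof.
move=> Az; have [r r0 Hr] := attracting_disk.
have /basinP/(_ r r0)[N HN] := Az.
have rN := HN N (leqnn N).
have [|d d0 Hd] := @iter_continuous N z (r - nm (it N z - p)); first by rewrite subr_gt0.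
exists d => // w /Hd wz; apply/(basin_iter N).
have [|//] := Hr (it N w); have := nm_dist (it N w) (it N z) p; lra.
Qed.

(* The disk [u |-> it n z + 2 * (y - it n z) * u], which reaches [y] at [u = 1/2],
   stays well inside the ball of radius [e]: this is where [e / 8] comes from. *)
Lemma pull_back_link n x e y z : 0 < e ->
  (forall w, nm (w - x) < e -> A w) ->
  (forall c, (iter_poly n)^`().[c] = 0 -> e <= nm ((iter_poly n).[c] - x)) ->
  nm (it n z - x) < e / 8 -> nm (y - x) < e / 8 ->
  exists2 z', it n z' = y & link A z z'.
Proof.
move=> e0 eA ecrit zx yx; set F := iter_poly n in ecrit.
pose a := it n z; pose b : R[i] := 2 * (y - a).
have Fa : F.[z] = a by rewrite horner_iter_poly.
have b4 : nm b < e / 2.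
  rewrite /b nmM (_ : nm 2 = 2); last first.
    by rewrite -(rmorph_nat (real_complex R)) nm_real ger0_norm.
  by have := nm_dist y x a; rewrite (nmBC x a) -/a in zx *; lra.
have crit c : F^`().[c] = 0 -> 7 / 8 * e <= nm (F.[c] - a).
  by move=> /ecrit; have := nm_dist F.[c] a x; rewrite -/a in zx *; lra.
have [||g [ga Fg gc]] := @exists_section R F a z (3 / 4 * e) (7 / 8 * e)
  (size_iter_poly n) _ _ crit Fa.
- by lra.
- by lra.
have abu u : nm u < 1 -> nm (a + b * u - a) < e / 2.
  move=> u1; rewrite (addrC a) addrK nmM; apply: le_lt_trans b4.
  by rewrite ler_piMr ?nm_ge0 // ltW.
have cg w : nm (w - a) < e / 2 -> cont g w.
  move=> wa; apply/continuous_nmP => e1 e10.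
  have [|d d0 Hd] := gc w _ e1 e10; first by lra.
  exists (Num.min d (e / 4)); first by rewrite lt_min d0; lra.
  move=> v; rewrite lt_min => /andP[vd v4]; apply: Hd => //.
  by have := nm_dist v w a; lra.
have D0 w : nm (w - a) < e / 2 -> F^`().[g w] != 0.
  move=> wa; apply/eqP => /crit; rewrite Fg; lra.
have dg w : nm (w - a) < e / 2 -> isd g w (F^`().[g w])^-1.
  move=> wa; apply: (@is_derive_inverse_poly R F g w (e / 4)); [lra| |exact: cg|exact: D0].
  by move=> u uw; apply: Fg; have := nm_dist u w a; lra.
exists (g y).
  rewrite -horner_iter_poly Fg //; have := nm_dist y x a.
  by rewrite (nmBC x a) -/a in zx *; lra.
exists (fun u : R[i] => g (a + b * u)), (fun u : R[i] => b * (F^`().[g (a + b * u)])^-1).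
split; last 2 first.
- by rewrite mulr0 addr0.
- congr g; rewrite /b -mulrA mulrCA (_ : (2 : R[i]) * _ = 1) ?mulr1 ?[a + _]addrC ?subrK //.
  by rewrite -(rmorph_nat (real_complex R)) -rmorphM divff.
move=> u u1; have wa := abu u u1; split.
- apply/(basin_iter n); rewrite -horner_iter_poly Fg; last by lra.
  by apply: eA; have := nm_dist (a + b * u) a x; rewrite -/a in zx; lra.
- exact: is_derive_comp_affine (dg _ wa).
apply: continuous_mulc.
apply: (@continuous_inv R (fun u : R[i] => F^`().[g (a + b * u)])); last exact: D0.
have /continuous_nmP cga := continuous_comp_affine (cg _ wa).
apply/continuous_nmP => e1 e10.
have /continuous_nmP/(_ e1 e10)[d d0 Hd] := @horner_continuous R F^`() (g (a + b * u)).
by have [d' d'0 Hd'] := cga d d0; exists d' => // w /Hd'; exact: Hd.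
Qed.

End Dynamics.

(** * Good points *)

Section Good.
Variables (R : realType) (f : {poly R[i]}) (p : R[i]).
Hypothesis f_size : (1 < size f)%N.
Hypothesis f_attr : attracting_fixed_point f p.
Local Notation C := (Cplx R).
Implicit Types (n m k : nat) (x y z w c q u : R[i]) (e r : R).
Local Notation it n := (iter n (horner f)).
Local Notation A := (basin f p : set C).
Local Notation postcritical := (postcritical f).

Lemma seq_min (T : eqType) (s : seq T) (Q : T -> R -> Prop) :
  (forall (c : T) e e', Q c e -> e' <= e -> Q c e') ->
  (forall c : T, c \in s -> exists2 e, 0 < e & Q c e) ->
  exists2 e, 0 < e & forall c : T, c \in s -> Q c e.
Proof.
move=> Qle; elim: s => [|c s IH] H; first by exists 1.
have [e1 e10 H1] := H c (mem_head _ _).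
have [|e2 e20 H2] := IH; first by move=> d ds; apply: H; rewrite inE ds orbT.
exists (Num.min e1 e2); first by rewrite lt_min e10.
move=> d; rewrite inE => /orP[/eqP ->|/H2 Hd]; [apply: Qle H1 _|apply: Qle Hd _].
  by rewrite ge_min lexx.
by rewrite ge_min lexx orbT.
Qed.

Lemma seq_max (T : eqType) (s : seq T) (Q : T -> nat -> Prop) :
  (forall (c : T) k k', Q c k -> (k <= k')%N -> Q c k') ->
  (forall c : T, c \in s -> exists k, Q c k) ->
  exists k, forall c : T, c \in s -> Q c k.
Proof.
move=> Qle; elim: s => [|c s IH] H; first by exists 0%N.
have [k1 H1] := H c (mem_head _ _).
have [|k2 H2] := IH; first by move=> d ds; apply: H; rewrite inE ds orbT.
exists (maxn k1 k2) => d; rewrite inE => /orP[/eqP ->|/H2 Hd].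
  by apply: Qle H1 _; rewrite leq_maxl.
by apply: Qle Hd _; rewrite leq_maxr.
Qed.

Definition reach k z := exists q j, it j q = p /\ chain A k z q.

Definition good x := exists e k, 0 < e /\
  forall n z, nm (it n z - x) < e -> reach k z.

Definition good0 x := exists e k, 0 < e /\ forall z, nm (z - x) < e -> reach k z.

Lemma reach_leq k k' z : (k <= k')%N -> reach k z -> reach k' z.
Proof.
move=> kk' [q [j [jq zq]]]; exists q, j; split=> //.
exact: chain_pad kk' (basin_iter_preimage f_attr jq) zq.
Qed.

Lemma reach_link k z z' : link A z z' -> reach k z' -> reach k.+1 z.
Proof.
by move=> zz' [q [j [jq zq]]]; exists q, j; split=> //; exact: chain_cons zz' zq.
Qed.

Lemma reach_iter_preimage j z : it j z = p -> reach 0 z.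
Proof. by move=> jz; exists z, j; split => //; exact: chain_refl. Qed.

Lemma good_open x : good x ->
  exists2 e, 0 < e & forall w, nm (w - x) < e -> good w.
Proof.
move=> [e [k [e0 H]]]; exists (e / 2); first by lra.
move=> w wx; exists (e / 2), k; split; first by lra.
by move=> n z zw; apply: (H n); have := nm_dist (it n z) w x; lra.
Qed.

Lemma good_preimage x : good f.[x] -> good x.
Proof.
move=> [e [k [e0 H]]].
have [d d0 Hd] := @iter_continuous _ f 1%N x e e0.
by exists d, k; split => // n z /Hd; exact: (H n.+1).
Qed.

Lemma good_iter n x : good (it n x) -> good x.
Proof. by elim: n => //= n IH /good_preimage. Qed.

Lemma good_near x y e : 0 < e ->
  (forall w, nm (w - x) < e -> A w /\ ~ postcritical w) ->
  nm (y - x) < e / 8 -> good y -> good x.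
Proof.
move=> e0 He yx [e1 [k [e10 Hk]]]; exists (e / 8), k.+1; split; first by lra.
move=> n z zx.
have HA w : nm (w - x) < e -> A w by move=> /He[].
have Hc c : (iter_poly f n)^`().[c] = 0 -> e <= nm ((iter_poly f n).[c] - x).
  move=> c0; rewrite leNgt; apply/negP => /He[_]; apply.
  exact: critical_value_postcritical c0.
have [z' z'y zz'] := pull_back_link f_size e0 HA Hc zx yx.
by apply: reach_link zz' _; apply: (Hk n); rewrite z'y subrr nm0.
Qed.

Lemma good_iter_preimage_near x j e : 0 < e ->
  (forall w, nm (w - x) < e -> A w /\ ~ postcritical w) ->
  it j x = p -> good x.
Proof.
move=> e0 He jx; exists (e / 8), 1%N; split; first by lra.
move=> n z zx; have xx : nm (x - x) < e / 8 by rewrite subrr nm0; lra.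
have HA w : nm (w - x) < e -> A w by move=> /He[].
have Hc c : (iter_poly f n)^`().[c] = 0 -> e <= nm ((iter_poly f n).[c] - x).
  move=> c0; rewrite leNgt; apply/negP => /He[_]; apply.
  exact: critical_value_postcritical c0.
have [z' z'x zz'] := pull_back_link f_size e0 HA Hc zx xx.
apply: reach_link zz' (@reach_iter_preimage (j + n) _ _).
by rewrite iterD z'x.
Qed.

Lemma link_near x y z e : 0 < e -> (forall w, nm (w - x) < e -> A w) ->
  nm (z - x) < e / 8 -> nm (y - x) < e / 8 -> link A z y.
Proof.
move=> e0 He zx yx.
have Hc c : (iter_poly f 0)^`().[c] = 0 -> e <= nm ((iter_poly f 0).[c] - x).
  by rewrite /= derivX hornerC => /eqP; rewrite oner_eq0.
by have [z' <-] := @pull_back_link _ f p f_size 0 x e y z e0 He Hc zx yx.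
Qed.

Lemma good0_near x y e : 0 < e -> (forall w, nm (w - x) < e -> A w) ->
  nm (y - x) < e / 8 -> good y -> good0 x.
Proof.
move=> e0 He yx [e1 [k [e10 Hk]]]; exists (e / 8), k.+1; split; first by lra.
move=> z zx; apply: reach_link (link_near e0 He zx yx) _.
by apply: (Hk 0%N); rewrite subrr nm0.
Qed.

Lemma good0_iter_preimage x j : it j x = p -> good0 x.
Proof.
move=> jx; have [e e0 He] := basin_open f_attr (basin_iter_preimage f_attr jx).
exists (e / 8), 1%N; split; first by lra.
move=> z zx; apply: reach_link (link_near e0 He zx _) (reach_iter_preimage jx).
by rewrite subrr nm0; lra.
Qed.

Lemma preimages_in_seq x : exists s : seq R[i], forall y, f.[y] = x -> y \in s.
Proof.
have f0 : f - x%:P != 0.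
  rewrite -size_poly_gt0 size_polyDl; first exact: ltnW.
  by rewrite size_polyN size_polyC; apply: leq_ltn_trans f_size; case: (x != 0).
have [s _ Hs] := poly_roots f0; exists s => y fy.
have := Hs y; rewrite !hornerE fy subrr => /esym/eqP.
rewrite mulf_eq0 lead_coef_eq0 (negPf f0) /= prodf_seq_eq0 => /hasP[c cs /=].
by rewrite subr_eq0 => /eqP ->.
Qed.

Lemma critical_points_in_seq : exists s : seq R[i], forall c, f^`().[c] = 0 -> c \in s.
Proof.
have f0 := deriv_neq0 f_size.
have [s _ Hs] := poly_roots f0; exists s => y fy.
have := Hs y; rewrite fy => /esym/eqP.
rewrite mulf_eq0 lead_coef_eq0 (negPf f0) /= prodf_seq_eq0 => /hasP[c cs /=].
by rewrite subr_eq0 => /eqP ->.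
Qed.

(* No lift through a critical point is needed: the disks over a postcritical
   [x] are replaced by those over its preimages. *)
Lemma good_of_preimages x :
  good0 x -> (forall y, f.[y] = x -> good y) -> good x.
Proof.
move=> [e0 [k0 [e00 H0]]] Hx; have [s Hs] := preimages_in_seq x.
have [k Hk] : exists k, forall y, y \in s -> f.[y] = x -> exists2 e, 0 < e &
    forall n z, nm (it n z - y) < e -> reach k z.
  apply: seq_max => [c k k' H kk' /H[e egt0 He]|y _].
    by exists e => // n z /He; exact: reach_leq.
  have [fy|fy] := eqVneq f.[y] x; last by exists 0%N => /eqP; rewrite (negPf fy).
  by have [e [k [e1 He]]] := Hx y fy; exists k => _; exists e.
have [e e1 He] : exists2 e, 0 < e & forall y, y \in s -> f.[y] = x ->
    forall n z, nm (it n z - y) < e -> reach k z.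
  apply: seq_min => [c e e' H ee' fc n z zc|y ys].
    by apply: (H fc n); apply: lt_le_trans zc ee'.
  have [fy|fy] := eqVneq f.[y] x; last by exists 1 => // /eqP; rewrite (negPf fy).
  by have [e e1 He] := Hk y ys fy; exists e.
have [d d0 Hd] := root_near f_size e1.
exists (Num.min d e0), (maxn k k0); split; first by rewrite lt_min d0.
move=> [|n] z; rewrite lt_min => /andP[zd ze].
  by apply: reach_leq (H0 z ze); rewrite leq_maxr.
have [y fy yz] := Hd _ _ zd.
apply: reach_leq (leq_maxl _ _) _.
by apply: (He y (Hs y fy) fy n); rewrite nmBC.
Qed.

Lemma orbit_leaves x c : A x -> x != p -> exists N, forall m, (N <= m)%N -> it m c <> x.
Proof.
move=> Ax xp; have [Ac|nAc] := pselect (A c); last first.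
  by exists 0%N => m _ mc; apply: nAc; apply/(basin_iter f p m); rewrite mc.
have e0 : 0 < nm (x - p) by rewrite nm_gt0 subr_eq0.
have [N HN] := (basinP _ _ _).1 Ac _ e0.
by exists N => m /HN + mc; rewrite mc ltxx.
Qed.

Lemma postcritical_depth x : A x -> x != p ->
  exists N, forall m y, it m y = x -> (N <= m)%N -> ~ postcritical y.
Proof.
move=> Ax xp; have [s Hs] := critical_points_in_seq.
have [N HN] : exists N, forall c, c \in s -> forall m, (N <= m)%N -> it m c <> x.
  apply: seq_max => [c k k' H kk' m km|c _]; first by apply: H; exact: leq_trans km.
  exact: orbit_leaves.
exists N => m y my Nm [c [j [c0 yc]]].
apply: (HN c (Hs c c0) (m + j.+1)%N); first by rewrite (leq_trans Nm) ?leq_addr.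
by rewrite iterD -yc.
Qed.

Lemma not_postcritical_near x : A x -> x != p -> ~ postcritical x ->
  exists2 e, 0 < e & forall w, nm (w - x) < e -> A w /\ ~ postcritical w.
Proof.
move=> Ax xp nPx; have [s Hs] := critical_points_in_seq.
have [r r0 Hr] := basin_open f_attr Ax.
have [e e0 He] : exists2 e, 0 < e & forall c, c \in s -> f^`().[c] = 0 ->
    forall m, e <= nm (it m.+1 c - x).
  apply: seq_min => [c e e' H ee' c0 m|c _]; first by apply: le_trans (H c0 m).
  have [c0|c0] := eqVneq f^`().[c] 0; last by exists 1 => // /eqP; rewrite (negPf c0).
  have [Ac|nAc] := pselect (A c); last first.
    exists r => // _ m; rewrite leNgt; apply/negP => /Hr.
    by move=> /(basin_iter f p m.+1).
  have d0 : 0 < nm (x - p) / 2 by rewrite divr_gt0 // nm_gt0 subr_eq0.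
  have [N HN] := (basinP _ _ _).1 Ac _ d0.
  have [e e0 He] : exists2 e, 0 < e & forall m, (m < N)%N -> e <= nm (it m.+1 c - x).
    elim: N {HN} => [|N [e e0 He]]; first by exists 1.
    exists (Num.min e (nm (it N.+1 c - x))).
      rewrite lt_min e0 nm_gt0 subr_eq0; apply/eqP => cx; apply: nPx.
      by exists c, N.
    move=> m; rewrite ltnS leq_eqVlt ge_min => /orP[/eqP ->|/He -> //].
    by rewrite lexx orbT.
  exists (Num.min e (nm (x - p) / 2)); first by rewrite lt_min e0.
  move=> _ m; rewrite ge_min; have [/He -> //|Nm] := ltnP m N.
  apply/orP; right; have := HN m.+1 (leqW Nm); have := nm_dist x (it m.+1 c) p.
  by rewrite (nmBC x (it m.+1 c)); lra.
exists (Num.min r e); first by rewrite lt_min r0.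
move=> w; rewrite lt_min => /andP[/Hr Aw we]; split=> // -[c [m [c0 wc]]].
by have := He c (Hs c c0) c0 m; rewrite leNgt -wc we.
Qed.

Lemma good_iter_preimage w j : it j w = p -> w != p -> good w.
Proof.
move=> jw wp; have Aw := basin_iter_preimage f_attr jw.
have [N HN] := postcritical_depth Aw wp.
suff H d y m : it m y = w -> (N <= m + d)%N -> good y by exact: (H N w 0%N).
elim: d y m => [|d IH] y m my Nm.
  have yp : y != p.
    by apply: contraNneq wp => yp; rewrite -my yp iter_fixed.
  have jmy : it (j + m) y = p by rewrite iterD my.
  have [|e e0 He] := not_postcritical_near (basin_iter_preimage f_attr jmy) yp.
    by apply: HN my _; rewrite addn0 in Nm.
  exact: good_iter_preimage_near e0 He jmy.
apply: good_of_preimages.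
  by apply: (@good0_iter_preimage _ (j + m)); rewrite iterD my.
move=> y' fy'; apply: (IH y' m.+1); first by rewrite iterSr fy'.
by rewrite addSnnS.
Qed.

Lemma good_closed x : A x -> x != p ->
  (forall e, 0 < e -> exists2 y, nm (y - x) < e & good y) -> good x.
Proof.
move=> Ax xp clx; have [N HN] := postcritical_depth Ax xp.
suff H d y m : it m y = x -> (N <= m + d)%N ->
    (forall e, 0 < e -> exists2 t, nm (t - y) < e & good t) -> good y.
  exact: (H N x 0%N).
elim: d y m => [|d IH] y m my Nm cly;
  have Ay : A y by [apply/(basin_iter f p m); rewrite my].
  have yp : y != p.
    by apply: contraNneq xp => yp; rewrite -my yp iter_fixed.
  have [|e e0 He] := not_postcritical_near Ay yp.
    by apply: HN my _; rewrite addn0 in Nm.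
  have [|t ty gt] := cly (e / 8); first by lra.
  exact: good_near e0 He ty gt.
apply: good_of_preimages.
  have [e e0 He] := basin_open f_attr Ay.
  have [|t ty gt] := cly (e / 8); first by lra.
  exact: good0_near e0 He ty gt.
move=> y' fy'; apply: (IH y' m.+1); first by rewrite iterSr fy'.
  by rewrite addSnnS.
move=> e e0; have [d' d'0 Hd] := root_near f_size e0.
have [t ty gt] := cly d' d'0.
have [|y'' fy'' y''y'] := Hd y' t; first by rewrite fy' nmBC.
by exists y'' => //; apply: good_preimage; rewrite fy''.
Qed.

End Good.

Section Global.
Variables (R : realType) (f : {poly R[i]}) (p : R[i]).
Hypothesis f_size : (1 < size f)%N.
Hypothesis f_attr : attracting_fixed_point f p.
Local Notation C := (Cplx R).
Implicit Types (n m k : nat) (x y z w c q u a b : R[i]) (e r t s : R).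
Local Notation it n := (iter n (horner f)).
Local Notation A := (basin f p : set C).
Local Notation good := (good f p).

Lemma connected_clopen (T : topologicalType) (X G : set T) (x y : T) :
  connected X -> (forall z : T, X z -> G z -> \forall w \near z, G w) ->
  (forall z : T, X z -> (forall V, nbhs z V -> (V `&` G) !=set0) -> G z) ->
  X x -> G x -> X y -> G y.
Proof.
move=> cX oG cG Xx Gx Xy.
suff : X `&` G = X by move=> XG; move: Xy; rewrite -XG => -[].
apply: cX; first by exists x.
  exists (interior G); first exact: open_interior.
  apply/seteqP; split => z [Xz Gz]; split => //; first exact: oG.
  exact: interior_subset Gz.
exists (closure G); first exact: closed_closure.
apply/seteqP; split => z [Xz Gz]; split => //; first exact: subset_closure.
by apply: cG => // V /Gz[v [Gv Vv]]; exists v.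
Qed.

Lemma good_segment a b :
  (forall t, 0 <= t <= 1 -> A (a + t%:C%C * (b - a)) /\ a + t%:C%C * (b - a) != p) ->
  good a -> good b.
Proof.
move=> Hseg ga; pose g t := a + t%:C%C * (b - a).
pose L := nm (b - a) + 1; have L0 : 0 < L by rewrite ltr_wpDl ?nm_ge0.
have gB t s : nm (g t - g s) <= `|t - s| * L.
  have -> : g t - g s = (t - s)%:C%C * (b - a) by rewrite /g rmorphB; ring.
  by rewrite nmM nm_real ler_wpM2l // lerDl.
have : good (g 1).
  apply: (@connected_clopen R `[0%R, 1%R]%classic (fun t : R => good (g t)) 0 1) => /=.
  - exact: segment_connected.
  - move=> t _ /good_open[e e0 He]; apply/nbhs_realP; exists (e / L).
      by rewrite divr_gt0.
    by move=> s; rewrite ltr_pdivlMr // => st; apply: He; apply: le_lt_trans st.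
  - move=> t; rewrite in_itv /= => /Hseg[Agt gtp] cl.
    apply: good_closed => // e e0.
    have [|s [st gs]] := cl [set s | `|s - t| * L < e].
      by apply/nbhs_realP; exists (e / L); [rewrite divr_gt0|move=> s; rewrite ltr_pdivlMr].
    by exists (g s) => //; apply: le_lt_trans st.
  - by rewrite in_itv /= lexx ler01.
  - by rewrite /g mul0r addr0.
  - by rewrite in_itv /= lexx ler01.
by rewrite /g mul1r addrC subrK.
Qed.

Lemma good_punctured_disk r a b : (forall w, nm (w - p) < r -> A w) ->
  nm (a - p) < r -> nm (b - p) < r -> a != p -> b != p -> good a -> good b.
Proof.
move=> Hr.
have seg u v : nm (u - p) < r -> nm (v - p) < r ->
    (forall t, 0 <= t <= 1 -> u + t%:C%C * (v - u) != p) -> good u -> good v.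
  move=> ur vr H; apply: good_segment => t t01; split; last exact: H.
  apply: Hr; have -> : u + t%:C%C * (v - u) - p = (1 - t)%:C%C * (u - p) + t%:C%C * (v - p).
    by rewrite rmorphB rmorph1; ring.
  move: t01 => /andP[t0 t1]; apply: le_lt_trans (nmD _ _) _.
  rewrite !nmM !nm_real !ger0_norm ?subr_ge0 //.
  have [t12|t12] := leP t (1 / 2).
    have : t * nm (v - p) <= t * r by rewrite ler_wpM2l // ltW.
    have : (1 - t) * nm (u - p) < (1 - t) * r by rewrite ltr_pM2l //; lra.
    lra.
  have : t * nm (v - p) < t * r by rewrite ltr_pM2l //; lra.
  have : (1 - t) * nm (u - p) <= (1 - t) * r by rewrite ler_wpM2l ?subr_ge0 // ltW.
  lra.
move=> ar br ap bp ga.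
have [H|/existsNP[t /not_implyP[/andP[t0 t1] /negP]]] :=
    pselect (forall t, 0 <= t <= 1 -> a + t%:C%C * (b - a) != p).
  exact: (seg a b).
rewrite negbK => /eqP abp.
(* The segment from [a] to [b] meets [p]: go through [p + 'i (a - p)]. *)
have iE (x y : R) (d : R[i]) : d != 0 -> (x +i* y)%C * d = 0 -> x = 0 /\ y = 0.
  by move=> d0 /eqP; rewrite mulf_eq0 (negPf d0) orbF eq_complex /= => /andP[/eqP -> /eqP ->].
have ap0 : a - p != 0 by rewrite subr_eq0.
have bp0 : b - p != 0 by rewrite subr_eq0.
pose i : R[i] := (0 +i* 1)%C.
have nmi : nm i = 1 by rewrite /nm /= expr0n expr1n /= add0r sqrtr1.
pose v := p + i * (a - p).
have vr : nm (v - p) < r by rewrite /v addrC addKr nmM nmi mul1r.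
have cE (x y : R) : x%:C%C + y%:C%C * i = (x +i* y)%C.
  by apply/eqP; rewrite eq_complex /=; apply/andP; split; apply/eqP; ring.
have ba : t%:C%C * (b - p) = - ((1 - t)%:C%C * (a - p)).
  apply/eqP; rewrite -subr_eq0 opprK rmorphB rmorph1.
  have -> : t%:C%C * (b - p) + (1 - t%:C%C) * (a - p) = a + t%:C%C * (b - a) - p by ring.
  by rewrite abp subrr.
apply: (seg v b) => //.
  move=> s _; apply/eqP => vb.
  have : t%:C%C * (v + s%:C%C * (b - v) - p) = 0 by rewrite vb subrr mulr0.
  have -> : t%:C%C * (v + s%:C%C * (b - v) - p) =
      t%:C%C * ((1 - s%:C%C) * (i * (a - p))) + s%:C%C * (t%:C%C * (b - p)).
    by rewrite /v; ring.
  rewrite ba.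
  have -> : t%:C%C * ((1 - s%:C%C) * (i * (a - p))) + s%:C%C * - ((1 - t)%:C%C * (a - p)) =
      ((- (s * (1 - t)))%:C%C + (t * (1 - s))%:C%C * i) * (a - p).
    by rewrite !rmorphN !rmorphM !rmorphB !rmorph1; ring.
  rewrite cE => /(iE _ _ _ ap0)[s1 t2].
  have [t00|tN0] := eqVneq t 0.
    by move: ap; rewrite -abp t00 mul0r addr0 eqxx.
  have s1E : s = 1 by move/eqP: t2; rewrite mulf_eq0 (negPf tN0) subr_eq0 => /eqP.
  have t1E : t = 1 by move/eqP: s1; rewrite s1E mul1r oppr_eq0 subr_eq0 => /eqP.
  by move: bp; rewrite -abp t1E mul1r addrC subrK eqxx.
apply: (seg a v) => //.
move=> s _; apply/eqP => av.
have : a + s%:C%C * (v - a) - p = 0 by rewrite av subrr.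
have -> : a + s%:C%C * (v - a) - p = ((1 - s)%:C%C + s%:C%C * i) * (a - p).
  by rewrite /v rmorphB rmorph1; ring.
rewrite cE => /(iE _ _ _ ap0)[s1 s0].
lra.
Qed.

Lemma fixed_in_closure_good w : connected_component A p w -> f.[w] = p -> w != p ->
  forall e, 0 < e -> exists2 y, nm (y - p) < e & good y.
Proof.
move=> Ow fw wp e e0; apply: contrapT => N.
have gp : good p.
  apply: (@connected_clopen C (connected_component A p) good w p).
  - exact: component_connected.
  - by move=> z _ /good_open gz; apply/nbhs_nmP.
  - move=> z Oz cl; have cl' d : 0 < d -> exists2 y, nm (y - z) < d & good y.
      move=> d0; have [|y [yz gy]] := cl [set y | nm (y - z) < d]; last by exists y.
      by apply/nbhs_nmP; exists d.
    have [zp|zp] := eqVneq (z : R[i]) p.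
      by case: N; have := cl' e e0; rewrite zp.
    exact: good_closed (connected_component_sub Oz) zp cl'.
  - by [].
  - exact: (@good_iter_preimage _ _ _ _ _ w 1%N).
  - exact: connected_component_refl (basin_fixed f_attr).
by apply: N; exists p => //; rewrite subrr nm0.
Qed.

Lemma basin_good w : connected_component A p w -> f.[w] = p -> w != p ->
  forall z, A z -> z != p -> good z.
Proof.
move=> Ow fw wp z Az zp; have [r r0 Hr] := attracting_disk f_attr.
have Hr' v : nm (v - p) < r -> A v by move=> /Hr[].
have [a [ar ap ga]] : exists a, [/\ nm (a - p) < r, a != p & good a].
  have [y yr gy] := fixed_in_closure_good Ow fw wp r0.
  have [yp|yp] := eqVneq y p; last by exists y.
  rewrite yp in gy; have [e e0 He] := good_open gy.
  have m0 : 0 < Num.min r e / 2 by rewrite divr_gt0 // lt_min r0.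
  have mr : Num.min r e / 2 < r by have : Num.min r e <= r by [rewrite ge_min lexx]; lra.
  have me : Num.min r e / 2 < e by have : Num.min r e <= e by [rewrite ge_min lexx orbT]; lra.
  exists (p + (Num.min r e / 2)%:C%C); split.
  - by rewrite addrC addKr nm_real gtr0_norm.
  - by rewrite -subr_eq0 addrC addKr -nm_eq0 nm_real normr_eq0 gt_eqF.
  - by apply: He; rewrite addrC addKr nm_real gtr0_norm.
have [N HN] := (basinP _ _ _).1 Az _ r0.
have [zNp|zNp] := eqVneq (it N z) p.
  exact: good_iter_preimage zNp zp.
apply: (@good_iter _ _ _ N); apply: good_punctured_disk Hr' ar (HN N (leqnn N)) ap zNp ga.
Qed.

End Global.

Section Uniform.
Variable R : realType.
Local Notation C := (Cplx R).

Lemma uniform_on_bounded (E : R[i] -> Prop) (P : nat -> R[i] -> Prop) (M : R) :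
  (forall z, E z -> nm z <= M) ->
  (forall k k' z, (k <= k')%N -> P k z -> P k' z) ->
  (forall z, exists e k, 0 < e /\ forall w, nm (w - z) < e -> E w -> P k w) ->
  exists k, forall z, E z -> P k z.
Proof.
move=> EM Pmono loc.
have : compact (`[- M, M]%classic `*` `[- M, M]%classic : set (R * R)%type).
  by apply: compact_setX; exact: segment_compact.
move=> /compact_near_coveringP /(_ nat \oo (fun k ab => E (Complex ab.1 ab.2) ->
  P k (Complex ab.1 ab.2)) _)[].
  move=> [a b] _; have [e [k [e0 He]]] := loc (Complex a b).
  have e20 : 0 < e / 2 by lra.
  exists ((ball a (e / 2) `*` ball b (e / 2)), [set k' | (k <= k')%N]) => /=.
    split; last by exists k.
    by exists (ball a (e / 2), ball b (e / 2)) => //; split; exact: nbhsx_ballx.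
  move=> [[a' b'] k'] /= [[aa bb] kk'] Ez; apply: (Pmono k) => //.
  apply: He; last exact: Ez.
  move: aa bb; rewrite -!ball_normE /ball_ /= => aa bb.
  apply: (le_lt_trans (nm_le_ReIm (Complex a' b' - Complex a b))) => /=.
  by rewrite (distrC a') (distrC b'); lra.
move=> k _ /(_ k (leqnn k)) H; exists k => z Ez.
case: z Ez => a b Ez; apply: (H (a, b)) => //; have zM := EM _ Ez.
split; rewrite /= in_itv /=.
  by rewrite -ler_norml; apply: le_trans (nm_Re _) zM.
by rewrite -ler_norml; apply: le_trans (nm_Im _) zM.
Qed.

Lemma link_component (A : set C) (z1 : C) z w :
  link A z w -> connected_component A z1 z ->
  link (connected_component A z1) z w /\ connected_component A z1 w.
Proof.
move=> [h [dh [hA h0 h2]]] Oz.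
have Oh u : nm u < 1 -> connected_component A z1 (h u).
  move=> u1; apply: connected_component_trans Oz _.
  pose g (t : R) : C := h (0 + u * t%:C%C).
  have tu t : 0 <= t <= 1 -> nm (0 + u * t%:C%C) < 1.
    move=> /andP[t0 t1]; rewrite add0r nmM nm_real ger0_norm //.
    by apply: le_lt_trans u1; rewrite ler_piMr ?nm_ge0.
  have gc : connected (g @` `[0%R, 1%R]%classic).
    apply: connected_continuous_connected; first exact: segment_connected.
    apply: continuous_in_subspaceT => t; rewrite inE /= in_itv /= => /tu ut.
    apply: (@curve_continuous_comp R (fun v => h (0 + u * v)) id); first exact: cvg_id.
    have [_ hd _] := hA _ ut.
    exact: continuous_comp_affine (is_derive_continuous hd).
  apply: (connected_component_max _ _ gc).
  - exists 0; first by rewrite /= in_itv /= lexx ler01.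
    by rewrite /g rmorph0 mulr0 addr0 h0.
  - by move=> _ [t + <-]; rewrite /= in_itv /= => /tu/hA[].
  - exists 1; first by rewrite /= in_itv /= lexx ler01.
    by rewrite /g rmorph1 mulr1 add0r.
split; last by rewrite -h2; apply: Oh; rewrite nm_real ger0_norm //; lra.
by exists h, dh; split => // u u1; have [_ hd dhc] := hA u u1; split => //; exact: Oh.
Qed.

Lemma chain_component (A : set C) (z1 : C) k z w :
  chain A k z w -> connected_component A z1 z ->
  chain (connected_component A z1) k z w /\ connected_component A z1 w.
Proof.
move=> [c [<- <- cl]] O0.
have Oc i : (i <= k)%N -> connected_component A z1 (c i).
  by elim: i => // i IH ik; have [] := link_component (cl i ik) (IH (ltnW ik)).
split; last exact: Oc.
exists c; split => // i ik.
by have [] := link_component (cl i ik) (Oc i (ltnW ik)).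
Qed.

End Uniform.

Section Reach.
Variables (R : realType) (f : {poly R[i]}) (p : R[i]).
Hypothesis f_size : (1 < size f)%N.
Hypothesis f_attr : attracting_fixed_point f p.
Local Notation it n := (iter n (horner f)).
Local Notation A := (basin f p).

Lemma uniform_reach w : connected_component A p w -> f.[w] = p -> w != p ->
  exists k, forall z, A z -> reach f p k z.
Proof.
move=> Ow fw wp; have [r r0 Hr] := attracting_disk f_attr.
pose rho := r / 8; have rho0 : 0 < rho by rewrite /rho; lra.
pose E z := rho <= nm (z - p) /\ nm (f.[z] - p) <= rho.
have [M HM] := poly_coercive (rho + nm p) f_size.
have [k Hk] : exists k, forall z, E z -> forall n y, it n y = z -> reach f p k y.
  apply: (@uniform_on_bounded R E (fun k z => forall n y, it n y = z -> reach f p k y) M).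
  - by move=> z [_ fz]; apply: HM; have := nm_lB f.[z] p; lra.
  - by move=> k k' z kk' H n y /H; exact: reach_leq.
  move=> z; have [zr|zr] := ltP (nm (z - p)) rho.
    exists (rho - nm (z - p)), 0%N; split; first by rewrite subr_gt0.
    by move=> v vz [vp _]; have := nm_dist v z p; lra.
  have [fz|fz] := ltP rho (nm (f.[z] - p)).
    have [|d d0 Hd] := @iter_continuous _ f 1%N z (nm (f.[z] - p) - rho).
      by rewrite subr_gt0.
    exists d, 0%N; split => // v /Hd /= vz [_ vp].
    by have := nm_dist f.[z] f.[v] p; rewrite (nmBC f.[z] f.[v]); lra.
  have zp : z != p by apply: contraTneq zr => ->; rewrite subrr nm0 -ltNge.
  have Az : A z.
    by apply/(basin_preimage f p); have [|] := Hr f.[z]; first by rewrite /rho in fz; lra.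
  have [e [k [e0 He]]] := basin_good f_size f_attr Ow fw wp Az zp.
  exists e, k; split => // v vz _ n y ny.
  by apply: (He n); rewrite ny.
exists k.+1 => z Az.
have [N HN] := (basinP _ _ _).1 Az _ rho0.
have ex : exists n, nm (it n z - p) < rho by exists N; exact: HN.
case: (ex_minnP ex) => -[|n] nz nmin.
  apply: reach_leq (ltn0Sn k) _ => //.
  have pp : nm (p - p) < r / 8 by rewrite subrr nm0.
  apply: reach_link (link_near f_size r0 (fun w' wr => (Hr w' wr).1) nz pp) _.
  exact: (@reach_iter_preimage _ _ _ 0).
apply: reach_leq (leqnSn k) _ => //; apply: (Hk (it n z) _ n) => //.
split; last exact: ltW.
by rewrite leNgt; apply/negP => /nmin; rewrite ltnn.
Qed.

End Reach.

Theorem theorem8 (R : realType) (N : nat) (f : {poly R[i]}) (p : Cplx R)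
    (N_ge2 : (2 <= N)%N) (deg_f : size f = N.+1)
    (p_attr : attracting_fixed_point f p)
    (p_pre : iter_preimage f p 1 `&` immediate_basin f p <> [set p]) :
  exists Ct : R, forall Omega : set (Cplx R), basin_component f p Omega ->
    forall z0 : Cplx R, Omega z0 ->
      exists2 q : Cplx R, (Omega `&` \bigcup_k iter_preimage f p k) q &
        (kobayashi_dist Omega z0 q <= Ct%:E)%E.
Proof.
have f_size : (1 < size f)%N by rewrite deg_f ltnS (leq_trans _ N_ge2).
have [w [Ow fw wp]] :
    exists w, [/\ connected_component (basin f p) p w, f.[w] = p & w != p].
  apply: contrapT => H; apply: p_pre; apply/seteqP; split => [w [fw Ow]|_ ->].
    by apply: contrapT => /eqP wp; apply: H; exists w.
  split; first by case: p_attr.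
  exact: connected_component_refl (basin_fixed p_attr).
have [k Hk] := uniform_reach f_size p_attr Ow fw wp.
exists k.+1%:R => Omega [z1 _ ->] z0 Oz0.
have [q [j [jq zq]]] := reach_leq p_attr (leqnSn k) (Hk z0 (connected_component_sub Oz0)).
have [Ozq Oq] := chain_component zq Oz0.
exists q; first by split => //; exists j.
exact: kobayashi_dist_chain Ozq.
Qed.
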